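(* Let $T$ be a caterpillar all of whose vertices have odd degree, with diameter $k \leq 18$, and with $|V(T)| = 2^{n-1}$ for some positive integer $n$. Then $T$ is set-sequential.
   Context: A caterpillar is a tree containing a path (the center path) such that every vertex of the tree is at distance at most 1 from that path. The diameter of a connected graph is the largest distance between two of its vertices. A graph $G$ is set-sequential if, for some positive integer $m$, there is an assignment of distinct nonzero vectors of $\mathbb{F}_2^m$ to the vertices of $G$ such that, when each edge is labeled with the sum (mod 2) of the labels of its two endpoints, every nonzero vector of $\mathbb{F}_2^m$ occurs exactly once among all vertex labels and edge labels (in particular $|V(G)|+|E(G)| = 2^m-1$). *)

(* Defs.v *)
From HB Require Import structures.
From mathcomp Require Import all_boot all_order all_algebra.
Set Implicit Arguments.
Unset Strict Implicit.
Unset Printing Implicit Defensive.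
Import GRing.Theory.

(* A finite graph is an adjacency relation on a finite type of vertices. *)
Section Graph.
Variables (V : finType) (e : rel V).

Definition simple_graph : Prop := symmetric e /\ irreflexive e.

Definition degree (x : V) : nat := #|[set y | e x y]|.

Definition edges : {set {set V}} :=
  [set A | [exists x, exists y, e x y && (A == [set x; y])]].

Definition connected_graph : Prop :=
  (0 < #|V|) /\ forall x y : V, connect e x y.

(* For a simple graph, duplicate-free e-cycles of size 2 are just edges
   traversed back and forth; genuine cycles have size at least 3. *)
Definition acyclic : Prop := forall c : seq V, ucycle e c -> size c < 3.

Definition tree : Prop := [/\ simple_graph, connected_graph & acyclic].

Definition has_walk (x y : V) (d : nat) : bool :=
  [exists p : d.-tuple V, path e x p && (last x p == y)].

(* Least length of a walk from x to y. A shortest walk has length less than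
   #|V|, so the search range suffices; the value is #|V| when x and y are not
   connected. *)
Definition dist (x y : V) : nat := find (has_walk x y) (iota 0 #|V|).

Definition diameter : nat := \max_x \max_y dist x y.

Definition caterpillar : Prop :=
  tree /\
  exists (x : V) (p : seq V),
    [/\ path e x p, uniq (x :: p) &
        forall v : V, exists2 u, u \in x :: p & dist v u <= 1].

Local Open Scope ring_scope.

Definition edge_label (m : nat) (f : V -> 'rV['F_2]_m) (A : {set V})
    : 'rV['F_2]_m := \sum_(x in A) f x.

Definition set_sequential : Prop :=
  exists2 m : nat, (0 < m)%N &
  exists f : V -> 'rV['F_2]_m,
    [/\ injective f, forall x, f x != 0 &
        forall v : 'rV['F_2]_m, v != 0 ->
          (#|[set x | f x == v]|
           + #|[set A in edges | edge_label f A == v]| = 1)%N].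

End Graph.

(* Main.v *)
Require Import Defs.
From mathcomp Require Import all_boot all_order all_algebra zify.
Set Implicit Arguments.
Unset Strict Implicit.
Unset Printing Implicit Defensive.
Import GRing.Theory.

(** A caterpillar is determined by the numbers of leaves along its center path. If the center
    labels lie in a subspace [K] of dimension 5, then attaching leaves to the centers amounts
    to partitioning cosets of [K] into pairs [{x, x + c}], with [c] a center label. When
    leaves come in pairs, any 8 nonzero vectors of [K], each used twice, admit such a
    partition of [K]: if they do not span [K], split them between two cosets of a hyperplane
    of [K]; otherwise take five of them as a basis, and the positions of the other three are
    finitely many up to permuting the basis.

    So it suffices to label small cores containing all the centers: with 16 vertices in
    dimension 5 for at most 9 centers, and with 32 vertices in dimension 6, centers in a
    hyperplane, for 10 to 14 centers. These labelings come from a finite search. A path of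
    15 or 16 centers is completed to a path of 17 vertices by adding leaves. Such a path does
    not fit into a hyperplane, but it has labelings with any prescribed vertex [c_j] as the
    only one outside. As [16 N] pairs of leaves are to be attached to the 17 vertices, using
    [N] blocks of two cosets, some [c_j] receives at most [N] of them, and a block can absorb
    one such pair. *)

(** * Partitions into pairs with prescribed differences *)

(** A pair [(u, x)] stands for a leaf labelled [x] at a center labelled [u]; its edge then receives
    [op u x]. The operation is abstract so that the same notions serve bit sequences, used for
    computation, and row vectors. *)
Definition block (T U : Type) (op : U -> T -> T) (F : seq (U * T)) : seq T :=
  unzip2 F ++ [seq op p.1 p.2 | p <- F].

Definition fills (T U : eqType) (op : U -> T -> T) (ws : seq U) (S : seq T) :=
  exists2 F : seq (U * T), perm_eq (unzip1 F) ws & perm_eq (block op F) S.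

Lemma perm_block_cat (T U : eqType) (op : U -> T -> T) (F F' : seq (U * T)) :
  perm_eq (block op (F ++ F')) (block op F ++ block op F').
Proof. by rewrite /block /unzip2 !map_cat -!catA perm_cat2l perm_catCA. Qed.

Lemma perm_block (T U : eqType) (op : U -> T -> T) (F F' : seq (U * T)) :
  perm_eq F F' -> perm_eq (block op F) (block op F').
Proof. by move=> pF; rewrite /block perm_cat // /unzip2 perm_map. Qed.

Lemma fills_perm (T U : eqType) (op : U -> T -> T) (ws ws' : seq U) (S S' : seq T) :
  perm_eq ws ws' -> perm_eq S S' -> fills op ws S -> fills op ws' S'.
Proof.
move=> pw pS [F Fw FS]; exists F; [exact: perm_trans Fw pw|exact: perm_trans FS pS].
Qed.

Lemma fills_nil (T U : eqType) (op : U -> T -> T) : fills op [::] [::].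
Proof. by exists [::]. Qed.

Lemma fills_cat (T U : eqType) (op : U -> T -> T) (ws ws' : seq U) (S S' : seq T) :
  fills op ws S -> fills op ws' S' -> fills op (ws ++ ws') (S ++ S').
Proof.
move=> [F Fw FS] [F' Fw' FS']; exists (F ++ F').
  by rewrite /unzip1 map_cat perm_cat.
by apply: perm_trans (perm_block_cat _ _ _) _; rewrite perm_cat.
Qed.

Lemma fills_map (T U T' U' : eqType) (op : U -> T -> T) (op' : U' -> T' -> T')
    (f : U -> U') (g : T -> T') (ws : seq U) (S : seq T) :
  (forall u, u \in ws -> forall x, x \in S -> g (op u x) = op' (f u) (g x)) ->
  fills op ws S -> fills op' (map f ws) (map g S).
Proof.
move=> fg [F Fw FS]; exists [seq (f p.1, g p.2) | p <- F].
  rewrite /unzip1 -map_comp (eq_map (g := f \o fst)) // map_comp.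
  exact: perm_map.
suff -> : block op' [seq (f p.1, g p.2) | p <- F] = map g (block op F).
  exact: perm_map.
rewrite /block /unzip2 map_cat -!map_comp; congr (_ ++ _).
apply/eq_in_map => p pF /=; rewrite fg //.
  by rewrite -(perm_mem Fw) map_f.
by rewrite -(perm_mem FS) mem_cat (map_f snd pF).
Qed.

Lemma fills_cons (T U : eqType) (op : U -> T -> T) (w : U) (x : T)
    (ws : seq U) (S : seq T) :
  fills op ws S -> fills op (w :: ws) (x :: op w x :: S).
Proof.
move=> h; have {}h := fills_cat (ws := [:: w]) (S := [:: x; op w x]) _ h.
by apply: h; exists [:: (w, x)].
Qed.

Definition spread (T : Type) (cs : seq T) (l : seq nat) : seq T :=
  flatten [seq nseq p.2 p.1 | p <- zip cs l].

(** * Bit vectors and the search for pairings *)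

(** Nested conditionals stop at the first difference, whereas call-by-value evaluation would compute
    both arguments of [&&]. *)
Fixpoint beq (x y : seq bool) : bool :=
  match x, y with
  | [::], [::] => true
  | a :: x', b :: y' => if a then (if b then beq x' y' else false)
                        else (if b then false else beq x' y')
  | _, _ => false
  end.

Fixpoint bxor (x y : seq bool) : seq bool :=
  match x, y with
  | a :: x', b :: y' => (if a then ~~ b else b) :: bxor x' y'
  | _, _ => [::]
  end.

Fixpoint masks (d : nat) : seq (seq bool) :=
  if d is d'.+1 then
    [seq false :: x | x <- masks d'] ++ [seq true :: x | x <- masks d']
  else [:: [::]].

Fixpoint pull (y : seq bool) (R : seq (seq bool)) : option (seq (seq bool)) :=
  if R is x :: R' then
    if beq x y then Some R'
    else if pull y R' is Some R'' then Some (x :: R'') else None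
  else None.

Fixpoint pull_all (s R : seq (seq bool)) : option (seq (seq bool)) :=
  if s is y :: s' then
    if pull y R is Some R' then pull_all s' R' else None
  else Some R.

(* Depth-first search: the first uncovered point is paired using each still available
   difference in turn; [cs] lists the differences with their remaining multiplicities. *)
Fixpoint pfill (k : nat) (cs : seq (seq bool * nat)) (R : seq (seq bool)) : bool :=
  if k is k'.+1 then
    if R is p :: R' then
      (fix try (pre cs : seq (seq bool * nat)) : bool :=
         if cs is (v, c) :: cs' then
           if (if c is c'.+1 then
                 if pull (bxor v p) R' is Some R''
                 then pfill k' (catrev pre ((v, c') :: cs')) R'' else false
               else false)
           then true else try ((v, c) :: pre) cs'
         else false) [::] cs
    else all (fun c => if c.2 is 0 then true else false) cs
  else false.

Arguments pfill : simpl never.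

Lemma beqP (x y : seq bool) : beq x y -> x = y.
Proof.
by elim: x y => [|[] x IH] [|[] y] //= /IH ->.
Qed.

Lemma pullP (y : seq bool) (R R' : seq (seq bool)) :
  pull y R = Some R' -> perm_eq R (y :: R').
Proof.
elim: R R' => //= x R IH R'; case: ifP => [/beqP <- [<-] //|_].
case: (pull y R) IH => // R'' /(_ _ erefl) IH [<-].
by rewrite (perm_trans (y := x :: y :: R'')) ?perm_cons // (perm_catCA [:: x] [:: y]).
Qed.

Lemma pull_allP (s R R' : seq (seq bool)) :
  pull_all s R = Some R' -> perm_eq R (s ++ R').
Proof.
elim: s R R' => [R R' [->] //|y s IH R R' /=].
case E : (pull y R) => [R''|//] /IH H.
by apply: perm_trans (pullP E) _; rewrite perm_cons.
Qed.

Lemma pfillP (k : nat) (cs : seq (seq bool * nat)) (R : seq (seq bool)) :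
  pfill k cs R -> fills bxor (spread (unzip1 cs) (unzip2 cs)) R.
Proof.
rewrite /spread zip_unzip; elim: k cs R => // k IH cs [|p R].
  rewrite /pfill => h; suff -> : flatten [seq nseq p.2 p.1 | p <- cs] = [::] by exact: fills_nil.
  by elim: cs h => //= -[v [|c]] cs IHc //=; apply: IHc.
(* The inner loop is handled for every state of its scan: a reversed prefix of rejected differences
   and the rest of the list. *)
rewrite -[X in flatten (map _ X)]/(catrev [::] cs) /pfill -/pfill.
elim: cs [::] => [|[v c] cs IHc] pre //=.
case: ifP => [|_]; last exact: (IHc ((v, c) :: pre)).
case: c {IHc} => // c; case E : (pull _ _) => [R'|//] /IH h _.
apply: fills_perm (fills_cons v p h).
  rewrite !catrevE !map_cat !flatten_cat /= -cat1s perm_catCA perm_cat2l.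
  by [].
by rewrite perm_cons perm_sym; apply: pullP.
Qed.

Definition unit_masks (d : nat) : seq (seq bool) :=
  [seq [seq i == j | j <- iota 0 d] | i <- iota 0 d].

Arguments unit_masks : simpl never.

(** Nondecreasing sequences represent the orbits of coordinate patterns under permutations of the
    basis. *)
Fixpoint sorted_seqs (b k lo : nat) : seq (seq nat) :=
  if k is k'.+1 then
    flatten [seq [seq x :: s | s <- sorted_seqs b k' x] | x <- iota lo (b - lo)]
  else [:: [::]].

Definition bit0 (t : nat) := odd t.
Definition bit1 (t : nat) := odd t./2.
Definition bit2 (t : nat) := odd t./2./2.

(** The three bits of the [i]-th entry of [ts] are the coefficients of three extra vectors on the
    [i]-th basis vector. Patterns in which an extra vector vanishes are accepted outright. The fuel
    17 allows for 16 pairs and the final test. *)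
Definition rank5_instance (ts : seq nat) : bool :=
  let os := [:: map bit2 ts; map bit1 ts; map bit0 ts] in
  if has (all negb) os then true
  else pfill 17 [seq (x, 2) | x <- os ++ unit_masks 5] (masks 5).

Lemma rank5_instances : all rank5_instance (sorted_seqs 8 5 0).
Proof. vm_compute; reflexivity. Qed.

Lemma rank5_instanceP (ts : seq nat) :
  let os := [:: map bit2 ts; map bit1 ts; map bit0 ts] in
  rank5_instance ts ->
  has (all negb) os \/ pfill 17 [seq (x, 2) | x <- os ++ unit_masks 5] (masks 5).
Proof. by rewrite /rank5_instance; case: ifP => h; [left|right]. Qed.

Local Open Scope ring_scope.

(** * Doubled differences in dimension at most 5 *)

Notation vect m := 'rV['F_2]_m.
Notation vadd m := (@GRing.add (vect m)).

Lemma addvv (m : nat) (x : vect m) : x + x = 0.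
Proof.
by apply/rowP => i; rewrite !mxE; case: (x ord0 i) => -[|[]] // ?; apply/val_inj.
Qed.

Lemma addv_inj (m : nat) (x : vect m) : injective (+%R x).
Proof. exact: addrI. Qed.

(** * Coordinates, spans and independence over the field with two elements *)

Fixpoint lin (m : nat) (bs : seq (vect m)) (x : seq bool) : vect m :=
  match bs, x with
  | b :: bs', a :: x' => (if a then b else 0) + lin bs' x'
  | _, _ => 0
  end.

(** One entry per coordinate vector, repetitions included: the length is always a power of 2, and
    independence becomes the absence of repetitions, so dimension arguments are counting
    arguments. *)
Definition span (m : nat) (bs : seq (vect m)) : seq (vect m) :=
  [seq lin bs x | x <- masks (size bs)].

Definition indep (m : nat) (bs : seq (vect m)) : bool := uniq (span bs).

Lemma size_masks (d : nat) : size (masks d) = (2 ^ d)%N.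
Proof. by elim: d => //= d IH; rewrite size_cat !size_map IH addnn -mul2n expnS. Qed.

Lemma mem_masks (d : nat) (x : seq bool) : (x \in masks d) = (size x == d).
Proof.
have memc (b c : bool) (y : seq bool) s :
    (b :: y \in [seq c :: z | z <- s]) = (b == c) && (y \in s).
  apply/mapP/andP => [[z zs [-> ->]]|[/eqP -> ys]]; last by exists y.
  by rewrite eqxx.
elim: d x => [|d IH] [|a x] //=; last by rewrite mem_cat !memc IH; case: a; rewrite ?orbF.
by rewrite mem_cat; apply/negbTE/norP; split; apply/mapP => -[].
Qed.

Lemma lin_bxor (m : nat) (bs : seq (vect m)) (x y : seq bool) :
  size x = size y -> lin bs (bxor x y) = lin bs x + lin bs y.
Proof.
elim: x y bs => [|a x IH] [|b y] [|c bs] //=; rewrite ?addr0 // => -[/IH ->].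
rewrite addrACA; congr (_ + _).
by case: a b => [] []; rewrite ?addvv ?addr0 ?add0r.
Qed.

Lemma size_span (m : nat) (bs : seq (vect m)) : size (span bs) = (2 ^ size bs)%N.
Proof. by rewrite size_map size_masks. Qed.

Lemma span_cons (m : nat) (b : vect m) (bs : seq (vect m)) :
  span (b :: bs) = span bs ++ map (+%R b) (span bs).
Proof.
rewrite /span /= map_cat -!map_comp; congr (_ ++ _).
by apply: eq_map => x /=; rewrite add0r.
Qed.

Lemma span0 (m : nat) (bs : seq (vect m)) : 0 \in span bs.
Proof. by elim: bs => [|b bs IH]; rewrite ?span_cons ?mem_cat ?IH // inE. Qed.

Lemma size_bxor (x y : seq bool) : size x = size y -> size (bxor x y) = size x.
Proof. by elim: x y => [|a x IH] [|b y] //= [/IH ->]. Qed.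

Lemma span_add (m : nat) (bs : seq (vect m)) (u v : vect m) :
  u \in span bs -> v \in span bs -> u + v \in span bs.
Proof.
move=> /mapP[x]; rewrite mem_masks => /eqP sx ->.
move=> /mapP[y]; rewrite mem_masks => /eqP sy ->.
by rewrite -lin_bxor ?sx ?sy // map_f // mem_masks size_bxor ?sx ?sy.
Qed.

Lemma span_basis (m : nat) (bs : seq (vect m)) : {subset bs <= span bs}.
Proof.
elim: bs => [|b bs IH] u //; rewrite span_cons mem_cat inE => /orP[/eqP ->|/IH ->//].
by have := map_f (+%R b) (span0 bs); rewrite addr0 => ->; rewrite orbT.
Qed.

Lemma span_sub (m : nat) (cs bs : seq (vect m)) :
  {subset cs <= span bs} -> {subset span cs <= span bs}.
Proof.
elim: cs => [|c cs IH] h u.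
  by rewrite /span /= inE => /eqP ->; apply: span0.
have {}IH : {subset span cs <= span bs}.
  by apply: IH => v vc; apply: h; rewrite inE vc orbT.
rewrite span_cons mem_cat => /orP[/IH //|/mapP[v /IH vb ->]].
by apply: span_add => //; apply: h; rewrite mem_head.
Qed.

Lemma span_consS (m : nat) (b : vect m) (bs : seq (vect m)) :
  {subset span bs <= span (b :: bs)}.
Proof. by move=> u; rewrite span_cons mem_cat => ->. Qed.

Lemma indep_cons (m : nat) (b : vect m) (bs : seq (vect m)) :
  indep (b :: bs) = (b \notin span bs) && indep bs.
Proof.
rewrite /indep span_cons cat_uniq (map_inj_uniq (@addv_inj _ b)).
rewrite andbA andbC; case: (uniq _); rewrite ?andbF //= andbT.
congr (~~ _); apply/hasP/idP => [[v /mapP[u us ->] bus]|bs_b].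
  by rewrite -(addr0 b) -(addvv u) addrA span_add.
by exists b => //; have := map_f (+%R b) (span0 bs); rewrite addr0.
Qed.

Lemma indep_size (m : nat) (cs bs : seq (vect m)) :
  indep cs -> {subset cs <= span bs} -> (size cs <= size bs)%N.
Proof.
move=> ic /span_sub sub; have := uniq_leq_size ic sub.
by rewrite !size_span leq_exp2l.
Qed.

Lemma indep_full (m : nat) (cs bs : seq (vect m)) :
  indep cs -> indep bs -> {subset cs <= span bs} -> size cs = size bs ->
  perm_eq (span cs) (span bs).
Proof.
move=> ic ib /span_sub sub ss; apply: uniq_perm => //.
have [|_ h u] := uniq_min_size ic sub; last by rewrite h.
by rewrite !size_span ss.
Qed.

Lemma indep_perm (m : nat) (cs bs : seq (vect m)) :
  perm_eq cs bs -> indep bs -> indep cs.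
Proof.
move=> p ib; apply: (leq_size_uniq ib).
  by apply: span_sub => u ub; apply: span_basis; rewrite (perm_mem p).
by rewrite !size_span (perm_size p).
Qed.

Lemma extend_indep (m : nat) (cs bs : seq (vect m)) :
  indep cs -> indep bs -> (size cs < size bs)%N ->
  exists2 t, t \in span bs & indep (t :: cs).
Proof.
move=> ic ib lt_cb.
have [/allP sub|/allPn[t tb tc]] := boolP (all (mem (span cs)) bs).
  by have := indep_size ib sub; rewrite leqNgt lt_cb.
by exists t; [apply: span_basis|rewrite indep_cons tc].
Qed.

Lemma extend_indep_to (m k : nat) (cs bs : seq (vect m)) :
  indep cs -> indep bs -> {subset cs <= span bs} -> (size cs <= k <= size bs)%N ->
  exists ds, [/\ indep ds, size ds = k, {subset ds <= span bs}
                & {subset span cs <= span ds}].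
Proof.
move=> ic ib sub; elim: k => [|k IH].
  by rewrite leqn0 => /andP[/eqP s0 _]; exists cs; split.
rewrite leq_eqVlt => /andP[/orP[/eqP <- _|lt_ck lt_kb]].
  by exists cs; split.
have [|ds [ids sds subd subc]] := IH; first by rewrite -ltnS lt_ck ltnW.
have [|t tb it] := extend_indep ids ib; first by rewrite sds.
exists (t :: ds); split=> //=; first by rewrite sds.
  by move=> u; rewrite inE => /orP[/eqP ->//|/subd].
by move=> u /subc; apply: span_consS.
Qed.

Lemma extract_basis (m : nat) (ws : seq (vect m)) :
  exists cs os, [/\ perm_eq ws (cs ++ os), indep cs & {subset os <= span cs}].
Proof.
elim: ws => [|w ws [cs [os [p ic sub]]]]; first by exists [::], [::]; split.
have [wc|wc] := boolP (w \in span cs).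
  exists cs, (w :: os); split=> //.
    by rewrite perm_sym (perm_catCA cs [:: w] os) /= perm_cons perm_sym.
  by move=> u; rewrite inE => /orP[/eqP ->//|/sub].
exists (w :: cs), os; split; first by rewrite /= perm_cons.
  by rewrite indep_cons wc.
by move=> u /sub; apply: span_consS.
Qed.

Lemma fills_lin (m : nat) (cs : seq (vect m)) (ws : seq (seq bool)) :
  (forall x, x \in ws -> size x = size cs) ->
  fills bxor ws (masks (size cs)) -> fills (vadd m) (map (lin cs) ws) (span cs).
Proof.
move=> sw; apply: fills_map => u /sw su x; rewrite mem_masks => /eqP sx.
by rewrite lin_bxor // su sx.
Qed.

Lemma fills_shift (m : nat) (t : vect m) (ws S : seq (vect m)) :
  fills (vadd m) ws S -> fills (vadd m) ws (map (+%R t) S).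
Proof.
move=> h; rewrite -[ws]map_id; apply: fills_map h => u _ x _.
by rewrite addrCA.
Qed.

Lemma lin_zip (m : nat) (p : seq (vect m * nat)) (f : nat -> bool) :
  lin (unzip1 p) (map f (unzip2 p)) = \sum_(x <- p) (if f x.2 then x.1 else 0).
Proof. by elim: p => [|x p IH] /=; rewrite ?big_nil ?big_cons ?IH. Qed.

Lemma lin_units (m : nat) (cs : seq (vect m)) :
  map (lin cs) (unit_masks (size cs)) = cs.
Proof.
have lin0 (bs : seq (vect m)) i n : (i < n)%N ->
    lin bs [seq i == j | j <- iota n (size bs)] = 0.
  elim: bs n => //= b bs IH n lt_in.
  by rewrite (ltn_eqF lt_in) IH ?add0r // ltnW.
suff H (bs : seq (vect m)) n :
    [seq lin bs [seq i == j | j <- iota n (size bs)] | i <- iota n (size bs)] = bs.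
  by rewrite /unit_masks -map_comp; apply: H.
elim: bs n => //= b bs IH n; rewrite eqxx lin0 // addr0; congr (_ :: _).
rewrite -[RHS](IH n.+1); apply/eq_in_map => i; rewrite mem_iota => /andP[lt_ni _].
by rewrite (gtn_eqF lt_ni) add0r.
Qed.
Lemma mem_sorted_seqs (b k lo : nat) (s : seq nat) :
  size s = k -> path leq lo s -> all (fun x => (x < b)%N) s -> s \in sorted_seqs b k lo.
Proof.
elim: k lo s => [|k IH] lo [|x s] //= [ss] /andP[lox ps] /andP[xb sb].
apply/flatten_mapP; exists x; last by apply/map_f/IH.
by rewrite mem_iota lox /= subnKC // (leq_trans lox (ltnW xb)).
Qed.

Lemma bits3 (a b c : bool) :
  let t := (a + (b + c.*2).*2)%N in
  [/\ (t < 8)%N, bit0 t = a, bit1 t = b & bit2 t = c].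
Proof. by case: a b c => [] [] []. Qed.

Lemma spread2 (T : eqType) (xs : seq T) :
  perm_eq (spread xs (nseq (size xs) 2%N)) (xs ++ xs).
Proof.
elim: xs => //= x xs IH.
rewrite /spread /= -/(spread _ _) perm_cons.
by rewrite perm_sym (perm_catCA xs [:: x] xs) /= perm_cons perm_sym.
Qed.

Lemma pfill_double (m k d : nat) (cs : seq (vect m)) (os : seq (seq bool)) :
  size cs = d -> (forall x, x \in os -> size x = d) ->
  pfill k [seq (x, 2%N) | x <- os ++ unit_masks d] (masks d) ->
  fills (vadd m) ((map (lin cs) os ++ cs) ++ (map (lin cs) os ++ cs)) (span cs).
Proof.
move=> <- so /pfillP; set ms := os ++ _.
have -> : unzip1 [seq (x, 2%N) | x <- ms] = ms by rewrite /unzip1 -map_comp map_id.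
have -> : unzip2 [seq (x, 2%N) | x <- ms] = nseq (size ms) 2%N.
  by elim: (ms) => //= x s ->.
move=> /(fills_perm (spread2 _) (perm_refl _)) /fills_lin.
rewrite map_cat /ms map_cat lin_units; apply=> x.
rewrite mem_cat orbb mem_cat => /orP[/so //|/mapP[i _ ->]].
by rewrite size_map size_iota.
Qed.

Lemma fills_double_basis4 (m : nat) (cs : seq (vect m)) :
  size cs = 4%N -> fills (vadd m) (cs ++ cs) (span cs).
Proof. by move=> s4; apply: (@pfill_double _ 9 4 cs [::]). Qed.

Lemma all_negb_lin (m : nat) (cs : seq (vect m)) (x : seq bool) :
  all negb x -> lin cs x = 0.
Proof. by elim: x cs => [|[] x IH] [|c cs] //= /IH ->; rewrite addr0. Qed.

(** Each basis vector is coded by its three coefficients in [a], [b], [c]. Sorting the basis by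
    these codes gives [ds], for which the pattern is one of the tabulated instances. *)
Lemma fills_double_basis5 (m : nat) (cs : seq (vect m)) (a b c : vect m) :
  size cs = 5%N -> a != 0 -> b != 0 -> c != 0 ->
  a \in span cs -> b \in span cs -> c \in span cs ->
  let ws := [:: c; b; a] ++ cs in
  exists2 ds, perm_eq cs ds & fills (vadd m) (ws ++ ws) (span ds).
Proof.
move=> s5 an bn cn /mapP[x + ax] /mapP[y + bx] /mapP[z + cx].
rewrite !mem_masks s5 => /eqP sx /eqP sy /eqP sz.
pose ts := [seq (p.1.1 + (p.1.2 + p.2.*2).*2)%N | p : bool * bool * bool <- zip (zip x y) z].
have st : size ts = 5%N by rewrite size_map !size_zip sx sy sz.
have [tlt tx ty tz] : [/\ all (fun t => (t < 8)%N) ts, map bit0 ts = x,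
                          map bit1 ts = y & map bit2 ts = z].
  have : size y = size x /\ size z = size x by rewrite sx sy sz.
  rewrite /ts; clear; elim: x y z => [|a x IH] [|b y] [|c z] //= [] // [sy] [sz].
  have [h0 h1 h2 h3] := bits3 a b c; have [i0 i1 i2 i3] := IH _ _ (conj sy sz).
  by rewrite i0 h0 h1 h2 h3 i1 i2 i3.
(* The basis vectors travel with their codes, so the three combinations are unchanged by the
   sorting. *)
pose p := sort (fun u v : vect m * nat => (u.2 <= v.2)%N) (zip cs ts).
have pp : perm_eq p (zip cs ts) by rewrite perm_sort.
have szct : size cs = size ts by rewrite s5 st.
have pc : perm_eq cs (unzip1 p).
  by rewrite perm_sym -[X in perm_eq _ X](@unzip1_zip _ _ cs ts) ?szct // perm_map.
have pt : perm_eq (unzip2 p) ts.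
  by rewrite -[X in perm_eq _ X](@unzip2_zip _ _ cs ts) ?szct // perm_map.
have linp f : lin cs (map f ts) = lin (unzip1 p) (map f (unzip2 p)).
  rewrite lin_zip (perm_big _ pp) /= -lin_zip unzip1_zip ?unzip2_zip ?szct //.
have s5' : size (unzip1 p) = 5%N by rewrite -(perm_size pc).
have inst : rank5_instance (unzip2 p).
  apply: (allP rank5_instances); apply: mem_sorted_seqs.
  - by rewrite (perm_size pt).
  - rewrite path_min_sorted; last by apply/allP.
    by rewrite sorted_map; apply: sort_sorted => u v; apply: leq_total.
  - by rewrite (perm_all _ pt).
exists (unzip1 p) => //.
have [/hasP[o + /all_negb_lin h]|] := rank5_instanceP inst.
  rewrite !inE => /or3P[] /eqP E; move: (h _ (unzip1 p)); rewrite E -linp.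
  - by rewrite tz -cx => /eqP; rewrite (negbTE cn).
  - by rewrite ty -bx => /eqP; rewrite (negbTE bn).
  - by rewrite tx -ax => /eqP; rewrite (negbTE an).
move=> /(pfill_double s5') H; apply: fills_perm (H _) => //.
  rewrite [map _ [:: _; _; _]]/= -!linp tx ty tz -ax -bx -cx.
  by rewrite perm_cat // perm_cat2l perm_sym.
move=> o; rewrite !inE => /or3P[] /eqP ->; rewrite size_map.
all: by rewrite (perm_size pt) st.
Qed.

Lemma perm_double_cat (T : eqType) (s t : seq T) :
  perm_eq ((s ++ s) ++ (t ++ t)) ((s ++ t) ++ (s ++ t)).
Proof. by rewrite -!catA perm_cat2l perm_catCA. Qed.

(** Induction on the dimension, with dimension 2 done by hand. If [ws] does not span, a hyperplane
    contains it and each of the two cosets takes half of [ws]. If it spans, counting leaves only a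
    basis in dimension 4, or a basis and three more vectors in dimension 5. *)
Lemma fills_double (m d : nat) (bs ws : seq (vect m)) :
  (2 <= d <= 5)%N -> indep bs -> size bs = d -> size ws = (2 ^ (d - 2))%N ->
  {subset ws <= span bs} -> 0 \notin ws -> fills (vadd m) (ws ++ ws) (span bs).
Proof.
elim: d bs ws => // d IH bs ws dle ib sb sw sub w0.
have [d1|d1] := eqVneq d 1%N.
  move: sw; rewrite d1; case: ws sub w0 {IH} => [|w []] // sub; rewrite inE eq_sym => w0 _.
  have iw : indep [:: w] by rewrite indep_cons !inE w0.
  have [|t tb it] := extend_indep iw ib; first by rewrite sb d1.
  apply: (@fills_perm _ _ _ [:: w; w] _ (span [:: t; w])) => //.
    apply: indep_full => //; last by rewrite sb d1.
    by move=> u; rewrite !inE => /orP[/eqP ->//|/eqP ->]; rewrite sub ?mem_head.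
  exists [:: (w, 0); (w, t)] => //.
  rewrite /block /span /= !addr0 !add0r addrC.
  by rewrite perm_cons (perm_catCA [:: t] [:: w]).
have d2 : (2 <= d)%N by move: dle; rewrite ltnS; case: d d1 {IH sb sw} => [|[]].
have [cs [os [pw ic oc]]] := extract_basis ws.
have cb : {subset cs <= span bs}.
  by move=> u uc; apply: sub; rewrite (perm_mem pw) mem_cat uc.
have := indep_size ic cb; rewrite leq_eqVlt => /orP[/eqP sc|lt_cb].
  have sz : (size cs + size os = 2 ^ (d.+1 - 2))%N by rewrite -sw (perm_size pw) size_cat.
  have on0 u : u \in os -> u != 0.
    by move=> uo; apply: contraNneq w0 => <-; rewrite (perm_mem pw) mem_cat uo orbT.
  (* The dimension is [d.+1]: in dimension 3 two vectors cannot span, in dimension 4 the four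
     vectors are a basis, in dimension 5 three vectors remain beside a basis. *)
  case: d {IH} d1 d2 dle sb sw sz => [|[|[|[|[|d]]]]] // _ _ _ sb sw.
  - by rewrite sc sb.
  - rewrite sc sb => /eqP; rewrite -{2}[4%N]addn0 eqn_add2l size_eq0 => /eqP o0.
    apply: fills_perm (fills_double_basis4 (etrans sc sb)).
      by move: pw; rewrite o0 cats0 perm_sym => pw; rewrite perm_cat.
    by apply: indep_full; rewrite ?sc.
  rewrite sc sb => /eqP; rewrite -[(2 ^ _)%N]/(5 + 3)%N eqn_add2l => /eqP so.
  case: os so pw oc on0 => [|c [|b [|a []]]] // _ pw oc on0.
  have [||||||ds pd] := @fills_double_basis5 _ cs a b c (etrans sc sb);
    do ?[by apply: on0; rewrite !inE eqxx ?orbT|by apply: oc; rewrite !inE eqxx ?orbT].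
  apply: fills_perm.
    have p' : perm_eq ([:: c; b; a] ++ cs) ws by rewrite perm_sym (perm_trans pw) // perm_catC.
    by rewrite perm_cat.
  have pd' : perm_eq ds cs by rewrite perm_sym.
  apply: indep_full => //; first exact: indep_perm ic.
    by move=> u; rewrite (perm_mem pd'); apply: cb.
  by rewrite (perm_size pd').
(* [ds] spans a hyperplane containing [ws], and [t] represents its other coset. *)
have [|ds [ids sds dsb csd]] := extend_indep_to (k := d) ic ib cb.
  by rewrite -ltnS -{1}sb lt_cb sb leqnSn.
have [|t tb it] := extend_indep ids ib; first by rewrite sds sb.
have wd : {subset ws <= span ds}.
  move=> u; rewrite (perm_mem pw) mem_cat => /orP[uc|/oc /csd //].
  exact/csd/span_basis.
have half : (2 ^ (d.+1 - 2) = 2 ^ (d - 2) + 2 ^ (d - 2))%N.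
  by rewrite subSn // expnS mul2n addnn.
have fd us : size us = (2 ^ (d - 2))%N -> {subset us <= ws} ->
    fills (vadd m) (us ++ us) (span ds).
  move=> su uw; apply: IH => //.
  - by move: dle; rewrite d2 => /andP[_ /ltnW].
  - by move=> v /uw /wd.
  - by apply: contra w0 => /uw.
pose k := (2 ^ (d - 2))%N.
apply: (@fills_perm _ _ _ ((take k ws ++ take k ws) ++ (drop k ws ++ drop k ws))
  _ (span (t :: ds))).
- by apply: perm_trans (perm_double_cat _ _) _; rewrite cat_take_drop.
- apply: indep_full; rewrite //= ?sds //.
  by move=> u; rewrite inE => /orP[/eqP ->//|/dsb].
rewrite span_cons; apply: fills_cat; last apply: fills_shift; apply: fd.
- by rewrite size_takel // sw half leq_addr.
- exact: mem_take.
- by rewrite size_drop sw half addnK.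
- exact: mem_drop.
Qed.

Lemma perm_span_enum (m : nat) (bs : seq (vect m)) :
  indep bs -> size bs = m -> perm_eq (span bs) (enum {: vect m}).
Proof.
move=> ib sb; apply: uniq_perm => //; first exact: enum_uniq.
have [||_ h] // := @uniq_min_size _ (span bs) (enum {: vect m}) ib.
  by move=> u _; rewrite mem_enum.
by rewrite -cardE card_mx card_Fp // mul1n size_span sb.
Qed.

(** * Doubled differences on two cosets of a space of dimension 5 *)

Lemma fills_two_cosets (m : nat) (z : vect m) (bs ws : seq (vect m)) :
  indep bs -> size bs = 5%N -> size ws = 16%N -> {subset ws <= span bs} -> 0 \notin ws ->
  fills (vadd m) (ws ++ ws) (span (z :: bs)).
Proof.
move=> ib sb sw sub w0; rewrite span_cons.
have fd us : size us = 8%N -> {subset us <= ws} -> fills (vadd m) (us ++ us) (span bs).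
  move=> su uw; apply: (@fills_double _ 5) => //; first by move=> v /uw /sub.
  by apply: contra w0 => /uw.
apply: (@fills_perm _ _ _ ((take 8 ws ++ take 8 ws) ++ (drop 8 ws ++ drop 8 ws))) => //.
  by apply: perm_trans (perm_double_cat _ _) _; rewrite cat_take_drop.
apply: fills_cat; last apply: fills_shift; apply: fd.
- by rewrite size_takel // sw.
- exact: mem_take.
- by rewrite size_drop sw.
- exact: mem_drop.
Qed.

(* Pairings of [span bs] and of its coset by [z] are made to share one pair of difference
   [w]; deleting both copies leaves [w] used twice overall, and the four points that are
   freed form two pairs of difference [z]. *)
Lemma fills_two_cosets_cross (m : nat) (z : vect m) (bs ws : seq (vect m)) :
  indep bs -> size bs = 5%N -> size ws = 15%N -> {subset ws <= span bs} -> 0 \notin ws ->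
  fills (vadd m) ((z :: ws) ++ (z :: ws)) (span (z :: bs)).
Proof.
move=> ib sb; case: ws => [|w ws] // [sw] sub w0; rewrite span_cons.
have fd us : size us = 7%N -> {subset us <= ws} -> exists x, exists2 F,
    perm_eq (unzip1 F) (w :: (us ++ us)) & perm_eq (x :: w + x :: block (vadd m) F) (span bs).
  move=> su uw.
  have sub' : {subset w :: us <= w :: ws}.
    by move=> v; rewrite !inE => /orP[->//|/uw ->]; rewrite orbT.
  have [|||F pF bF] := @fills_double _ 5 bs (w :: us) isT ib sb.
  - by rewrite /= su.
  - by move=> v /sub' /sub.
  - by apply: contra w0 => /sub'.
  have /mapP[[w' x] wF /= Ew] : w \in unzip1 F by rewrite (perm_mem pF) mem_head.
  subst w'; exists x, (rem (w, x) F).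
    rewrite -(perm_cons w).
    have -> : w :: unzip1 (rem (w, x) F) = unzip1 ((w, x) :: rem (w, x) F) by [].
    apply: (@perm_trans _ (unzip1 F)); first by rewrite perm_map // perm_sym perm_to_rem.
    apply: perm_trans pF _; rewrite /= perm_cons.
    by rewrite (perm_catCA us [:: w]) /= perm_cons.
  apply: perm_trans bF; apply: (@perm_trans _ (block (vadd m) ((w, x) :: rem (w, x) F))).
    rewrite /block /= perm_cons.
    by rewrite perm_sym (perm_catCA _ [:: w + x]).
  by apply: perm_block; rewrite perm_sym perm_to_rem.
have [||x [F pF bF]] := fd (take 7 ws); first by rewrite size_takel // sw.
  exact: mem_take.
have [||y [G pG bG]] := fd (drop 7 ws); first by rewrite size_drop sw.
  exact: mem_drop.
(* Translation by [t] sends the freed points [y], [w + y] of the second pairing to [z + x],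
   [z + (w + x)], which differ by [z] from the freed points of the first. As [x + y] lies in the
   span, it yields the same coset as translation by [z]. *)
pose t := z + (x + y).
pose G' := [seq (p.1, t + p.2) | p <- G].
have uG : unzip1 G' = unzip1 G by rewrite /G' /unzip1 -map_comp.
have xs : x \in span bs by rewrite -(perm_mem bF) mem_head.
have ys : y \in span bs by rewrite -(perm_mem bG) mem_head.
have blG : block (vadd m) G' = map (+%R t) (block (vadd m) G).
  rewrite /block /G' /unzip2 map_cat -!map_comp; congr (_ ++ _).
  by apply: eq_map => p /=; rewrite addrCA.
have sG : perm_eq (map (+%R t) (span bs)) (map (+%R z) (span bs)).
  have pxy : perm_eq (map (+%R (x + y)) (span bs)) (span bs).
    have uq : uniq (map (+%R (x + y)) (span bs)) by rewrite map_inj_uniq //; exact: addv_inj.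
    have sb' : {subset map (+%R (x + y)) (span bs) <= span bs}.
      by move=> u /mapP[v vs ->]; rewrite !span_add.
    apply: uniq_perm => //; have [|_ h u] := uniq_min_size uq sb'; last by rewrite h.
    by rewrite !size_map.
  move: (span bs) pxy => K pxy; apply: perm_trans (perm_map (+%R z) pxy).
  rewrite -map_comp.
  by rewrite (eq_map (g := +%R t)) // => u; rewrite /t /= !addrA.
exists ((z, x) :: (z, w + x) :: F ++ G').
  rewrite /= /unzip1 map_cat -/(unzip1 F) -/(unzip1 G') uG.
  apply: (@perm_trans _ (z :: z :: (w :: (take 7 ws ++ take 7 ws)) ++
                                   (w :: (drop 7 ws ++ drop 7 ws)))).
    by rewrite !perm_cons perm_cat.
  rewrite /= perm_cons perm_sym (perm_catCA (w :: ws) [:: z]) /= !perm_cons perm_sym.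
  rewrite (perm_catCA (take 7 ws ++ take 7 ws) [:: w]) /=.
  rewrite perm_sym (perm_catCA ws [:: w]) /= perm_cons perm_sym.
  by apply: perm_trans (perm_double_cat _ _) _; rewrite cat_take_drop.
have bG2 := perm_trans (perm_map (+%R t) bG) sG.
apply: perm_trans (perm_cat bF bG2).
rewrite [map _ (y :: _)]/= -blG.
have -> : t + y = z + x by rewrite /t -!addrA addvv addr0.
have -> : t + (w + y) = z + (w + x).
  by rewrite /t [w + y]addrC addrA -!addrA (addrA y) addvv add0r [x + w]addrC.
apply: (@perm_trans _ (x :: w + x :: z + x :: z + (w + x) ::
                        (block (vadd m) F ++ block (vadd m) G'))).
  rewrite -[(z, x) :: _]/([:: (z, x); (z, w + x)] ++ (F ++ G')).
  apply: perm_trans (perm_block_cat _ _ _) _.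
  rewrite {1}/block /= !perm_cons; exact: perm_block_cat.
rewrite /= !perm_cons perm_sym (perm_catCA _ [:: z + x; z + (w + x)]) /=.
by rewrite !perm_cons.
Qed.

(** * Labelings of caterpillars given by leaf counts *)

Definition path_edges (T U : Type) (op : T -> T -> U) (cs : seq T) : seq U :=
  if cs is c :: cs' then pairmap op c cs' else [::].

(* [l] lists the number of leaves attached to the successive vertices of a path. *)
Definition labeling (m : nat) (l : seq nat) (cs : seq (vect m))
    (F : seq (vect m * vect m)) : Prop :=
  [/\ size cs = size l, perm_eq (unzip1 F) (spread cs l) &
      perm_eq (0 :: cs ++ path_edges (vadd m) cs ++ block (vadd m) F) (enum {: vect m})].

Definition realizable (m : nat) (l : seq nat) : Prop :=
  exists cs F, @labeling m l cs F.

Definition add_double (b a : seq nat) : seq nat := [seq (p.1 + p.2.*2)%N | p <- zip b a].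

Lemma spread_cons (T : Type) (c : T) (cs : seq T) (x : nat) (l : seq nat) :
  spread (c :: cs) (x :: l) = nseq x c ++ spread cs l.
Proof. by []. Qed.

Lemma spread_add_double (T : eqType) (cs : seq T) (b a : seq nat) :
  size b = size a ->
  perm_eq (spread cs (add_double b a)) (spread cs b ++ (spread cs a ++ spread cs a)).
Proof.
elim: cs b a => [|c cs IH] [|x b] [|y a] //= [sba].
rewrite -[add_double _ _]/((x + y.*2)%N :: add_double b a) !spread_cons.
apply/permP => P; rewrite !count_cat (permP (IH _ _ sba)) !count_cat !count_nseq.
rewrite mulnDr -addnn mulnDr.
by rewrite [X in _ = (_ + X)%N]addnACA [RHS]addnACA.
Qed.

Lemma mem_spread (T : eqType) (cs : seq T) (l : seq nat) : {subset spread cs l <= cs}.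
Proof.
move=> u /flatten_mapP[[c x] cx]; rewrite mem_nseq /= => /andP[_ /eqP ->].
elim: cs l cx => [|d cs IH] [|y l] //=; rewrite !inE => /orP[/eqP[-> _]|/IH ->].
  by rewrite eqxx.
by rewrite orbT.
Qed.

Lemma size_spread (T : Type) (cs : seq T) (l : seq nat) :
  size cs = size l -> size (spread cs l) = sumn l.
Proof.
elim: cs l => [|c cs IH] [|x l] //= [/IH sl].
by rewrite spread_cons size_cat size_nseq sl.
Qed.

Lemma perm_enum_row (r m : nat) :
  perm_eq (enum {: vect (r + m)})
    (flatten [seq [seq row_mx x h | x <- enum {: vect r}] | h <- enum {: vect m}]).
Proof.
apply: uniq_perm; first exact: enum_uniq.
  apply: allpairs_uniq_dep => [|h _|]; do ?exact: enum_uniq.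
  by move=> [h x] [h' x'] _ _ /= /eq_row_mx[-> ->].
move=> u; rewrite mem_enum inE; apply/esym/flatten_mapP.
exists (rsubmx u); first by rewrite mem_enum.
by apply/mapP; exists (lsubmx u); rewrite ?mem_enum ?hsubmxK.
Qed.

(** The differences lie in the first factor, so a pairing of that factor can be translated to its
    coset at any [h]. *)
Lemma fills_chunks (r m : nat) (hs : seq (vect m)) (chs : seq (seq (vect r))) :
  size hs = size chs ->
  (forall ch, ch \in chs -> fills (vadd r) (ch ++ ch) (enum {: vect r})) ->
  let i x : vect (r + m) := row_mx x 0 in
  fills (vadd (r + m)) (map i (flatten chs ++ flatten chs))
    (flatten [seq [seq row_mx x h | x <- enum {: vect r}] | h <- hs]).
Proof.
move=> + + i; elim: hs chs => [|h hs IH] [|ch chs] //= => [_ _|[ss] hf]; first exact: fills_nil.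
apply: (@fills_perm _ _ _ (map i (ch ++ ch) ++ map i (flatten chs ++ flatten chs))) => //.
  by rewrite -map_cat perm_map //; apply: perm_double_cat.
apply: fills_cat; last by apply: IH => // c cc; apply: hf; rewrite inE cc orbT.
apply: (@fills_map _ _ _ _ (vadd r)); last by apply: hf; rewrite mem_head.
by move=> u _ x _; rewrite /i add_row_mx add0r.
Qed.

Lemma map_path_edges (T : eqType) (T' : Type) (op : T -> T -> T) (op' : T' -> T' -> T')
    (f : T -> T') (cs : seq T) :
  {in cs &, {morph f : x y / op x y >-> op' x y}} ->
  path_edges op' (map f cs) = map f (path_edges op cs).
Proof.
case: cs => //= c cs; elim: cs c => //= d cs IH c fM.
rewrite fM ?inE ?eqxx ?orbT // IH // => x y xd yd.
by apply: fM; rewrite inE ?xd ?yd orbT.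
Qed.

Lemma map_spread (T T' : Type) (f : T -> T') (cs : seq T) (l : seq nat) :
  spread (map f cs) l = map f (spread cs l).
Proof.
elim: cs l => [|c cs IH] [|x l] //=.
by rewrite !spread_cons map_cat map_nseq IH.
Qed.

(** The core occupies the coset at 0 of the first factor; each of the other [2 ^ m - 1] cosets
    absorbs one chunk of the pairs of leaves still to be attached. *)
Lemma realizable_extend (r m : nat) (b a : seq nat) (cs : seq (vect r))
    (F : seq (vect r * vect r)) (chs : seq (seq (vect r))) :
  labeling b cs F -> size b = size a -> size chs = (2 ^ m).-1 ->
  perm_eq (flatten chs) (spread cs a) ->
  (forall ch, ch \in chs -> fills (vadd r) (ch ++ ch) (enum {: vect r})) ->
  realizable (r + m) (add_double b a).
Proof.
move=> [sc pF pL] sba sch pch hf.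
pose i x : vect (r + m) := row_mx x 0.
have iM : {morph i : x y / x + y} by move=> x y; rewrite /i add_row_mx addr0.
have sh : size (rem 0 (enum {: vect m})) = size chs.
  by rewrite sch size_rem ?mem_enum // -cardE card_mx card_Fp // mul1n.
have [G pG bG] := fills_chunks sh hf.
exists (map i cs), ([seq (i p.1, i p.2) | p <- F] ++ G); split.
- by rewrite size_map sc size_map size_zip -sba minnn.
- rewrite map_spread /unzip1 map_cat -map_comp.
  apply: (@perm_trans _ (map i (unzip1 F) ++ map i (spread cs a ++ spread cs a))).
    rewrite /unzip1 -!map_comp perm_cat2l; apply: perm_trans pG _.
    by rewrite perm_map // perm_cat.
  rewrite -map_cat; apply: perm_map; rewrite perm_sym.
  apply: perm_trans (spread_add_double _ sba) _.
  by apply: perm_cat => //; rewrite perm_sym.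
rewrite perm_sym; apply: perm_trans (perm_enum_row _ _) _.
apply: (@perm_trans _ (flatten [seq [seq row_mx x h | x <- enum {: vect r}]
   | h <- 0 :: rem 0 (enum {: vect m})])).
  apply: perm_flatten; apply: perm_map; apply: perm_to_rem.
  by rewrite mem_enum.
rewrite /= -/i.
apply: perm_trans (perm_cat (perm_map i _) _) _.
- by rewrite perm_sym; exact: pL.
- by rewrite perm_sym; exact: bG.
have E : map i (block (vadd r) F) = block (vadd (r + m)) [seq (i p.1, i p.2) | p <- F].
  rewrite /block /unzip2 map_cat -!map_comp; congr (_ ++ _).
  by apply: eq_map => p /=; rewrite iM.
rewrite map_cons map_cat map_cat E /i row_mx0 -/i cat_cons perm_cons -catA perm_cat2l.
rewrite -catA (map_path_edges (in2W iM)) perm_cat2l perm_sym.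
exact: perm_block_cat.
Qed.

Lemma path_edges_rcons (m : nat) (c y : vect m) (cs : seq (vect m)) :
  path_edges (vadd m) (rcons (c :: cs) y)
    = rcons (path_edges (vadd m) (c :: cs)) (last c cs + y).
Proof. by elim: cs c => //= d cs IH c; rewrite IH. Qed.

Lemma path_edges_rev (m : nat) (cs : seq (vect m)) :
  path_edges (vadd m) (rev cs) = rev (path_edges (vadd m) cs).
Proof.
case: cs => // c cs; elim: cs c => // d cs IH c.
rewrite rev_cons [rev (d :: cs)]lock.
case E : (locked (rev (d :: cs))) => [|x s].
  by move: (congr1 size E); rewrite -lock size_rev.
rewrite path_edges_rcons -E -lock IH [in RHS]/= rev_cons; congr (rcons _ _).
suff -> : last x s = d by rewrite addrC.
by rewrite -[LHS]/(last 0 (x :: s)) -E -lock rev_cons last_rcons.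
Qed.

Lemma realizable_rev (m : nat) (l : seq nat) : realizable m l -> realizable m (rev l).
Proof.
move=> [cs [F [sc pF pL]]]; exists (rev cs), F; split; first by rewrite !size_rev.
  apply: perm_trans pF _; rewrite /spread -rev_zip // map_rev.
  by apply: perm_flatten; rewrite perm_sym perm_rev.
apply: perm_trans pL; rewrite perm_cons path_edges_rev.
by apply: perm_cat; [|apply: perm_cat]; rewrite ?perm_rev.
Qed.

(** An end of the path without leaves is itself a leaf of its neighbor: both lists of counts
    describe the same tree, and only the reading of the labels changes. *)
Lemma realizable_absorb (m x : nat) (l : seq nat) :
  realizable m (0%N :: x :: l) -> realizable m (x.+1 :: l).
Proof.
move=> [[|c [|d cs]] [F [//= sc pF pL]]].
exists (d :: cs), ((d, c) :: F); split; first by case: sc => /= ->.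
  by rewrite /= spread_cons /= perm_cons; move: pF; rewrite !spread_cons.
apply: perm_trans pL; rewrite perm_cons /=.
apply/permP => P; rewrite /block /= !(count_cat, count_map) /= !count_cat /= [d + c]addrC.
rewrite !(addnCA _ (nat_of_bool (P c))) !(addnCA _ (nat_of_bool (P (c + d)))).
by [].
Qed.

Lemma basis_exists (m : nat) : exists2 E : seq (vect m), indep E & size E = m.
Proof.
have [cs [os [pw ic oc]]] := extract_basis (enum {: vect m}).
exists cs => //; apply/eqP; rewrite -(eqn_exp2l _ _ (isT : 1 < 2)%N) -size_span.
have -> : (2 ^ m)%N = size (enum {: vect m}) by rewrite -cardE card_mx card_Fp // mul1n.
apply/eqP/perm_size/uniq_perm; rewrite ?enum_uniq // => u.
rewrite mem_enum inE; have : u \in enum {: vect m} by rewrite mem_enum.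
by rewrite (perm_mem pw) mem_cat => /orP[/span_basis|/oc].
Qed.

Lemma labeling_lin (r : nat) (E : seq (vect r)) (l : seq nat) (cs : seq (seq bool))
    (F : seq (seq bool * seq bool)) :
  indep E -> size E = r -> size cs = size l -> perm_eq (unzip1 F) (spread cs l) ->
  perm_eq (nseq r false :: cs ++ path_edges bxor cs ++ block bxor F) (masks r) ->
  labeling l (map (lin E) cs) [seq (lin E p.1, lin E p.2) | p <- F].
Proof.
move=> iE sE sc pF pL.
have szc x : x \in cs -> size x = r.
  by move=> xc; apply/eqP; rewrite -mem_masks -(perm_mem pL) inE mem_cat xc orbT.
split; first by rewrite size_map.
  by rewrite map_spread /unzip1 -map_comp -[X in perm_eq X _]/(map (lin E \o fst) F)
       map_comp perm_map.
apply: perm_trans (perm_span_enum iE sE); rewrite /span sE.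
have -> : 0 = lin E (nseq r false) by rewrite all_negb_lin // all_nseq orbT.
rewrite (@map_path_edges _ _ bxor); last first.
  by move=> x y /szc sx /szc sy; rewrite lin_bxor ?sx ?sy.
suff -> : block (vadd r) [seq (lin E p.1, lin E p.2) | p <- F] = map (lin E) (block bxor F).
  by rewrite -!map_cat -map_cons perm_map.
rewrite /block /unzip2 map_cat -!map_comp; congr (_ ++ _).
apply/eq_in_map => p pF' /=; rewrite lin_bxor // szc.
  apply/esym/eqP; rewrite -mem_masks -(perm_mem pL) inE !mem_cat.
  by rewrite /unzip2 (map_f snd pF') !orbT.
by apply: (@mem_spread _ _ l); rewrite -(perm_mem pF) map_f.
Qed.
Fixpoint bits (r x : nat) : seq bool :=
  if r is r'.+1 then rcons (bits r' x./2) (odd x) else [::].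

(** Removal from the duplicate-free list [masks r] succeeds only if zero and all labels of the core
    are pairwise distinct; the result is the list of labels still free. *)
Definition core_rest (r : nat) (b : seq nat) (cs lv : seq (seq bool)) :
    option (seq (seq bool)) :=
  if (size cs == size b) && (size lv == sumn b) then
    pull_all (nseq r false :: cs ++ path_edges bxor cs ++ block bxor (zip (spread cs b) lv))
             (masks r)
  else None.

Definition prepare (r : nat) (b : seq nat) (t : seq nat * seq nat) :
    option (seq (seq bool) * seq (seq bool)) :=
  let cs := map (bits r) t.1 in
  if core_rest r b cs (map (bits r) t.2) is Some R then Some (cs, R) else None.

Lemma size_bits (r x : nat) : size (bits r x) = r.
Proof. by elim: r x => //= r IH x; rewrite size_rcons IH. Qed.

Lemma prepare_labeling (r : nat) (E : seq (vect r)) (b a : seq nat)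
    (t : seq nat * seq nat) (cs R : seq (seq bool)) :
  indep E -> size E = r -> size a = size b -> prepare r b t = Some (cs, R) ->
  fills bxor (spread cs (map double a)) R ->
  size cs = size b /\ exists F, labeling (add_double b a) (map (lin E) cs) F.
Proof.
move=> iE sE sa; rewrite /prepare /core_rest; case: ifP => // /andP[/eqP s1 /eqP s2].
case Ep : (pull_all _ _) => [R'|//] [<- <-] [G pG bG]; split=> //.
have pm := pull_allP Ep; move: s1 s2 pG pm {Ep}.
set cs' := map _ t.1; set lv := map _ t.2 => s1 s2 pG pm.
pose F0 := zip (spread cs' b) lv.
have sF : size (spread cs' b) = size lv by rewrite size_spread // s2.
eexists; apply: (labeling_lin iE sE (F := F0 ++ G)).
- by rewrite /add_double size_map size_zip sa minnn.
- rewrite /unzip1 map_cat -/(unzip1 F0) -/(unzip1 G) /F0 unzip1_zip ?sF //.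
  rewrite perm_sym; apply: perm_trans (spread_add_double _ (esym sa)) _.
  apply: perm_cat => //; rewrite perm_sym; apply: perm_trans pG _.
  have -> : map double a = add_double (nseq (size a) 0%N) a by elim: (a) => //= x s ->.
  apply: perm_trans (spread_add_double _ _) _; first by rewrite size_nseq.
  suff -> : spread cs' (nseq (size a) 0%N) = [::] by [].
  elim: (a) (cs') => [|x s IH] [|c cs0] //=; by rewrite spread_cons IH.
rewrite perm_sym; apply: perm_trans pm _.
rewrite cat_cons perm_cons -catA perm_cat2l -catA perm_cat2l perm_sym.
by apply: perm_trans (perm_block_cat _ _ _) _; apply: perm_cat.
Qed.

Local Close Scope ring_scope.

(** * Cores *)

(* Each entry lists the labels of the [q] centers, then those of the leaves in the order of
   the centers; binary expansions of length [r], most significant bit first, encode vectors.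
   All the tables were found by a randomized computer search. *)
Definition cores (r q : nat) : seq (seq nat * seq nat) :=
  match r, q with
  | 3, 1 =>
     [:: ([:: 5], [:: 1; 2; 3])]
  | 4, 1 =>
     [:: ([:: 10], [:: 5; 6; 7])]
  | 4, 2 =>
     [:: ([:: 10; 9], [:: 1; 2; 6; 7])]
  | 4, 3 =>
     [:: ([:: 10; 9; 14], [:: 1; 5; 4; 2; 6])]
  | 5, 1 =>
     [:: ([:: 5], [:: 25; 26; 27])]
  | 5, 2 =>
     [:: ([:: 5; 8], [:: 18; 26; 19; 22])]
  | 5, 3 =>
     [:: ([:: 20; 3; 22], [:: 12; 14; 1; 13; 15])]
  | 5, 4 =>
     [:: ([:: 11; 7; 1; 17], [:: 20; 21; 26; 23; 10; 13])]
  | 5, 5 =>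
     [:: ([:: 26; 21; 20; 16; 27], [:: 12; 13; 10; 5; 14; 2; 3]);
      ([:: 17; 31; 12; 16; 8], [:: 7; 15; 10; 23; 13; 1; 3])]
  | 5, 6 =>
     [:: ([:: 10; 14; 7; 20; 13; 8], [:: 17; 21; 18; 29; 3; 2; 16; 22])]
  | 6, 10 =>
     [:: ([:: 21; 15; 9; 31; 2; 27; 7; 10; 4; 20], [:: 38; 44; 17; 43; 45; 61; 8; 11; 18; 1; 3;
        32]);
      ([:: 7; 9; 28; 6; 10; 19; 2; 18; 5; 30], [:: 4; 34; 54; 43; 42; 35; 11; 20; 15; 13; 1;
        32]);
      ([:: 1; 18; 14; 25; 22; 2; 11; 27; 10; 12], [:: 5; 36; 26; 40; 42; 43; 29; 21; 24; 13;
        48; 50]);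
      ([:: 29; 26; 22; 24; 8; 25; 20; 10; 15; 4], [:: 1; 46; 9; 3; 35; 55; 2; 18; 32; 36; 34;
        40]);
      ([:: 20; 28; 24; 27; 6; 31; 21; 5; 12; 2], [:: 46; 47; 34; 11; 49; 17; 1; 18; 32; 22; 15;
        52]);
      ([:: 22; 4; 6; 31; 16; 21; 9; 1; 11; 17], [:: 32; 36; 49; 24; 35; 41; 43; 20; 58; 39; 34;
        55])]
  | 6, 11 =>
     [:: ([:: 12; 26; 28; 17; 19; 29; 10; 21; 7; 3; 27], [:: 32; 63; 40; 41; 1; 36; 9; 15; 46;
        25; 8; 39; 47]);
      ([:: 11; 17; 13; 1; 3; 9; 25; 22; 8; 31; 7], [:: 48; 49; 37; 32; 60; 33; 29; 42; 5; 6;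
        27; 18; 43]);
      ([:: 17; 5; 16; 19; 23; 29; 6; 26; 12; 7; 31], [:: 25; 37; 50; 40; 32; 46; 34; 9; 47; 2;
        35; 1; 13]);
      ([:: 5; 3; 12; 18; 24; 26; 20; 28; 13; 22; 31], [:: 1; 35; 49; 25; 46; 32; 39; 7; 23; 16;
        34; 48; 53]);
      ([:: 2; 28; 11; 6; 7; 24; 5; 15; 27; 8; 26], [:: 12; 32; 36; 44; 58; 4; 17; 16; 25; 47;
        55; 33; 35]);
      ([:: 20; 31; 9; 17; 16; 26; 21; 18; 14; 29; 3], [:: 42; 43; 27; 32; 8; 34; 13; 44; 61; 2;
        45; 5; 52])]
  | 6, 12 =>
     [:: ([:: 13; 6; 2; 14; 19; 27; 17; 24; 15; 22; 21; 5], [:: 18; 51; 1; 30; 26; 40; 54; 58;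
        37; 32; 46; 44; 35; 48]);
      ([:: 7; 23; 17; 30; 2; 9; 1; 26; 5; 19; 10; 24], [:: 34; 51; 3; 12; 47; 62; 59; 42; 32;
        41; 36; 4; 21; 45]);
      ([:: 21; 1; 4; 6; 31; 23; 12; 22; 14; 3; 19; 28], [:: 11; 32; 34; 48; 60; 38; 10; 37; 46;
        9; 17; 44; 42; 51]);
      ([:: 10; 30; 16; 28; 21; 2; 25; 1; 5; 3; 11; 29], [:: 48; 61; 45; 31; 13; 41; 44; 43; 18;
        42; 32; 53; 26; 34]);
      ([:: 20; 22; 5; 6; 9; 18; 7; 16; 30; 4; 12; 13], [:: 32; 36; 10; 46; 57; 50; 11; 31; 38;
        61; 41; 17; 51; 55]);
      ([:: 15; 11; 12; 9; 25; 31; 23; 1; 21; 13; 28; 18], [:: 34; 36; 52; 50; 51; 44; 38; 29;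
        48; 40; 19; 32; 37; 41])]
  | 6, 13 =>
     [:: ([:: 7; 28; 12; 13; 6; 18; 5; 10; 3; 25; 29; 14; 17], [:: 57; 61; 43; 48; 33; 30; 63;
        35; 2; 21; 49; 50; 32; 34; 37]);
      ([:: 3; 15; 1; 20; 10; 2; 29; 25; 18; 27; 13; 23; 6], [:: 16; 52; 34; 47; 43; 35; 59; 24;
        36; 40; 7; 53; 50; 32; 48]);
      ([:: 12; 27; 29; 21; 1; 10; 24; 7; 9; 4; 30; 15; 25], [:: 35; 38; 57; 43; 5; 3; 39; 44;
        50; 58; 63; 32; 19; 41; 46]);
      ([:: 4; 12; 22; 17; 5; 6; 9; 16; 14; 29; 23; 21; 13], [:: 42; 59; 50; 32; 38; 52; 37; 48;
        11; 41; 1; 43; 47; 18; 33]);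
      ([:: 9; 1; 25; 2; 14; 11; 4; 26; 7; 23; 20; 18; 31], [:: 21; 34; 48; 19; 52; 32; 44; 56;
        35; 22; 63; 50; 47; 36; 42]);
      ([:: 14; 6; 1; 19; 12; 17; 15; 11; 27; 22; 28; 21; 2], [:: 20; 32; 3; 53; 43; 40; 44; 49;
        48; 34; 33; 42; 60; 37; 47])]
  | 6, 14 =>
     [:: ([:: 13; 20; 5; 14; 16; 3; 9; 21; 2; 6; 27; 26; 8; 7], [:: 33; 35; 43; 34; 56; 32; 57;
        53; 40; 36; 41; 37; 12; 51; 24; 42]);
      ([:: 7; 15; 24; 26; 16; 29; 22; 19; 31; 17; 21; 20; 18; 9], [:: 25; 46; 48; 61; 36; 51;
        42; 58; 49; 28; 39; 45; 32; 57; 33; 50]);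
      ([:: 6; 4; 1; 28; 15; 8; 22; 31; 14; 21; 24; 18; 25; 3], [:: 33; 41; 40; 53; 12; 34; 48;
        32; 38; 36; 43; 37; 46; 35; 23; 50])]
  | _, _ => [::]
  end.

Definition spine9_core : seq nat * seq nat :=
  ([:: 19; 20; 25; 29; 8; 26; 10; 6; 15], [:: 11; 14; 1; 22; 2; 27; 5]).

(* In entry [j], only the path vertex [j] lies outside the hyperplane of labels below 32. *)
Definition spine17_cores : seq (seq nat * seq nat) :=
     [:: ([:: 44; 23; 19; 2; 26; 7; 13; 3; 28; 5; 12; 30; 22; 16; 27; 20; 1], [:: 43; 48; 52;
        37; 33; 32; 57; 51; 56; 40; 55; 39; 50; 46; 42]);
      ([:: 19; 54; 27; 4; 26; 7; 13; 3; 17; 5; 25; 24; 16; 6; 9; 2; 23], [:: 12; 41; 51; 39;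
        63; 38; 32; 33; 47; 40; 52; 46; 36; 53; 57]);
      ([:: 19; 20; 50; 4; 26; 25; 23; 27; 29; 15; 10; 1; 16; 24; 21; 9; 31], [:: 59; 2; 61; 43;
        53; 35; 36; 46; 37; 39; 32; 40; 34; 41; 55]);
      ([:: 19; 20; 25; 35; 26; 24; 23; 27; 4; 17; 3; 9; 1; 29; 11; 14; 30], [:: 41; 33; 6; 49;
        40; 59; 52; 34; 39; 60; 36; 50; 42; 62; 32]);
      ([:: 19; 20; 25; 29; 57; 24; 23; 27; 17; 11; 3; 5; 16; 2; 30; 31; 22], [:: 63; 42; 47;
        14; 44; 34; 32; 60; 58; 61; 35; 40; 39; 46; 41]);
      ([:: 19; 20; 25; 29; 8; 38; 23; 27; 17; 15; 9; 31; 5; 14; 18; 2; 3], [:: 43; 44; 36; 60;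
        24; 33; 32; 56; 39; 58; 34; 42; 35; 55; 50]);
      ([:: 19; 20; 25; 29; 8; 26; 44; 3; 9; 17; 23; 1; 14; 11; 16; 28; 2], [:: 32; 41; 62; 53;
        45; 31; 57; 34; 63; 38; 36; 50; 33; 56; 39]);
      ([:: 19; 20; 25; 29; 8; 26; 10; 34; 17; 15; 23; 22; 31; 3; 5; 14; 12], [:: 38; 45; 35;
        39; 33; 55; 27; 41; 48; 60; 44; 46; 54; 37; 36]);
      ([:: 19; 20; 25; 29; 8; 26; 10; 6; 35; 17; 15; 24; 14; 11; 2; 3; 31], [:: 57; 41; 40; 55;
        38; 43; 34; 27; 59; 32; 46; 58; 44; 49; 61])].

(* The least leaf counts of an odd caterpillar with [q] centers, except for [K_2]. *)
Definition tight_base (q : nat) : seq nat :=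
  if q is q'.+2 then 2 :: rcons (nseq q' 1) 2 else [:: 3].

(** The ends of the path are themselves leaves of the tree, and inner vertices have degree 3. This
    gives 16 vertices for [q = 9] and 32 for [q = 17], so these cores exhaust dimensions 5 and 6. *)
Definition spine_base (q : nat) : seq nat := 0 :: rcons (nseq (q - 2) 1) 0.

Fixpoint compositions (q e : nat) : seq (seq nat) :=
  if q is q'.+1 then
    if q' is 0 then [:: [:: e]]
    else flatten [seq [seq x :: s | s <- compositions q' (e - x)] | x <- iota 0 e.+1]
  else [::].

(* The labels not used by a core must split into pairs accounting for [a i] further pairs of
   leaves at each center [i], for every [a] that completes the core to [2 ^ (r - 1)]
   vertices; reading an entry backwards gives another core. *)
Definition tight_check (r q : nat) : bool :=
  let t := cores r q in
  let prep := [seq x <- pmap (prepare r (tight_base q))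
                             (t ++ [seq (rev x.1, rev x.2) | x <- t]) |
                 (r < 6) || all (fun c => ~~ head true c) x.1] in
  all (fun a => has (fun x => pfill 33 (zip x.1 (map double a)) x.2) prep)
      (compositions q (2 ^ (r - 2) - q - 1)).

Definition spine17_check (j : nat) : bool :=
  if prepare 6 (spine_base 17) (nth ([::], [::]) spine17_cores j) is Some (cs, [::]) then
    all (fun i => head true (nth [::] cs i) == (i == j)) (iota 0 17)
  else false.

Lemma tight_check6 : all (tight_check 6) (iota 10 5).
Proof. by vm_compute. Qed.

Lemma tight_check5 : all (tight_check 5) (iota 1 6).
Proof. by vm_compute. Qed.

Lemma tight_check4 : all (tight_check 4) (iota 1 3).
Proof. by vm_compute. Qed.

Lemma tight_check3 : tight_check 3 1.
Proof. by vm_compute. Qed.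

Lemma spine17_checks : all spine17_check (iota 0 9).
Proof. by vm_compute. Qed.

Lemma spine17_checked (j : nat) : j < 9 -> spine17_check j.
Proof.
by move=> j9; apply: (allP spine17_checks); rewrite mem_iota.
Qed.

Lemma spine9_checked : exists cs, prepare 5 (spine_base 9) spine9_core = Some (cs, [::]).
Proof. by eexists; vm_compute. Qed.

(** * From the cores to all leaf counts *)

Lemma mem_compositions (a : seq nat) : a != [::] -> a \in compositions (size a) (sumn a).
Proof.
elim: a => [|x a IH] // _; case: a IH => [|y a] IH; first by rewrite /= addn0 mem_head.
apply/flatten_mapP; exists x; first by rewrite mem_iota /=; lia.
by apply: map_f; rewrite [sumn (x :: _)]/= addKn; apply: IH.
Qed.

Lemma add_double_cons (x y : nat) (b a : seq nat) :
  add_double (x :: b) (y :: a) = (x + y.*2) :: add_double b a.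
Proof. by []. Qed.

Lemma sumn_add_double (b a : seq nat) :
  size b = size a -> sumn (add_double b a) = sumn b + (sumn a).*2.
Proof.
by elim: b a => [|x b IH] [|y a] //= [/IH]; rewrite /add_double /= => ->; lia.
Qed.

Lemma size_add_double (b a : seq nat) : size b = size a -> size (add_double b a) = size b.
Proof. by move=> sb; rewrite size_map size_zip sb minnn. Qed.

Lemma add_doubleP (b l : seq nat) :
  size b = size l ->
  (forall i, i < size l -> nth 0 b i <= nth 0 l i /\ odd (nth 0 b i) = odd (nth 0 l i)) ->
  exists2 a, size a = size l & l = add_double b a.
Proof.
elim: b l => [|x b IH] [|y l] //= => [_ _|[sb] h]; first by exists [::].
have [|a sa E] := IH _ sb; first by move=> i il; apply: (h i.+1).
have [le_xy odd_xy] := h 0 isT.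
exists ((y - x)./2 :: a); first by rewrite /= sa.
by rewrite add_double_cons -E; congr (_ :: _); move: le_xy odd_xy => /=; lia.
Qed.

(** Used to spend [k] pairs of leaves on completing a core and to leave the others for the remaining
    cosets. *)
Lemma split_double (a : seq nat) (k : nat) : k <= sumn a ->
  exists a1 a2, [/\ size a1 = size a, size a2 = size a, sumn a1 = k, sumn a2 = sumn a - k &
    forall b, size b = size a -> add_double b a = add_double (add_double b a1) a2].
Proof.
elim: a k => [|x a IH] k /= le_k.
  by move: le_k; rewrite leqn0 => /eqP ->; exists [::], [::]; split=> // -[].
have [|a1 [a2 [s1 s2 u1 u2 h]]] := IH (k - minn k x); first by lia.
exists (minn k x :: a1), (x - minn k x :: a2); split; rewrite /= ?s1 ?s2 ?u1 ?u2 //; do ?lia.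
case=> [|y b] // [sb]; rewrite !add_double_cons h //; congr (_ :: _); lia.
Qed.

Lemma labeling_nz (m : nat) (l : seq nat) (cs : seq (vect m)) (F : seq (vect m * vect m)) :
  labeling l cs F -> (0%R \notin cs) && uniq cs.
Proof.
move=> [_ _ p]; have := enum_uniq {: vect m}; rewrite -(perm_uniq p) /= mem_cat cat_uniq.
by case/and3P => /norP[-> _] ->.
Qed.

Lemma reshape_chunks (T : eqType) (k c : nat) (s : seq T) :
  size s = k * c ->
  exists chs, [/\ size chs = k, flatten chs = s &
    forall ch, ch \in chs -> size ch = c /\ {subset ch <= s}].
Proof.
move=> ss; have sn : sumn (nseq k c) = size s by rewrite sumn_nseq ss mulnC.
exists (reshape (nseq k c) s).
have fl : flatten (reshape (nseq k c) s) = s by rewrite reshapeKr ?sn.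
have sh : shape (reshape (nseq k c) s) = nseq k c by rewrite reshapeKl ?sn.
split=> //; first by rewrite -(size_map size) -/(shape _) sh size_nseq.
move=> ch chi; split; last by move=> u uc; rewrite -fl; apply/flattenP; exists ch.
by have := map_f size chi; rewrite -/(shape _) sh mem_nseq => /andP[_ /eqP].
Qed.

Lemma realizable_chunks (r m c : nat) (b a : seq nat) (cs : seq (vect r))
    (F : seq (vect r * vect r)) :
  labeling b cs F -> size b = size a -> sumn a = (2 ^ m).-1 * c ->
  (forall ch, size ch = c -> {subset ch <= cs} -> fills (vadd r) (ch ++ ch) (enum {: vect r})) ->
  realizable (r + m) (add_double b a).
Proof.
move=> L sb sa hf; have [sc _ _] := L.
have [|chs [s1 s2 s3]] := @reshape_chunks _ (2 ^ m).-1 c (spread cs a).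
  by rewrite size_spread ?sa // sc.
apply: (realizable_extend L sb s1); first by rewrite s2.
move=> ch /s3[sch sub]; apply: hf => // u /sub; exact: mem_spread.
Qed.

Lemma realizable5 (m : nat) (b a : seq nat) (cs : seq (vect 5)) (F : seq (vect 5 * vect 5)) :
  labeling b cs F -> size b = size a -> sumn a = (2 ^ m).-1 * 8 ->
  realizable (5 + m) (add_double b a).
Proof.
move=> L sb sa; have [E iE sE] := basis_exists 5.
have /andP[nz _] := labeling_nz L.
apply: (realizable_chunks L sb sa) => ch sch sub.
apply: fills_perm (perm_span_enum iE sE) _ => //.
apply: (@fills_double _ 5) => // [u _|]; last by apply: contra nz => /sub.
by rewrite (perm_mem (perm_span_enum iE sE)) mem_enum.
Qed.

Lemma realizable6 (m : nat) (z : vect 6) (bs : seq (vect 6)) (b a : seq nat)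
    (cs : seq (vect 6)) (F : seq (vect 6 * vect 6)) :
  indep (z :: bs) -> size bs = 5 -> {subset cs <= span bs} ->
  labeling b cs F -> size b = size a -> sumn a = (2 ^ m).-1 * 16 ->
  realizable (6 + m) (add_double b a).
Proof.
move=> iE sE csb L sb sa.
have /andP[nz _] := labeling_nz L.
have ib : indep bs by move: iE; rewrite indep_cons => /andP[].
apply: (realizable_chunks L sb sa) => ch sch sub.
apply: fills_perm (perm_span_enum iE (congr1 S sE)) _ => //.
apply: fills_two_cosets => // [u /sub /csb //|]; by apply: contra nz => /sub.
Qed.

Lemma mem_spread_nth (T : eqType) (x0 : T) (cs : seq T) (a : seq nat) (u : T) :
  u \in spread cs a -> exists i, [/\ i < size cs, 0 < nth 0 a i & u = nth x0 cs i].
Proof.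
elim: cs a => [|c cs IH] [|x a] //; rewrite spread_cons mem_cat mem_nseq.
by case/orP => [/andP[x0' /eqP ->]|/IH[i [? ? ?]]]; [exists 0|exists i.+1].
Qed.

Lemma spread_extract (T : eqType) (x0 : T) (cs : seq T) (a : seq nat) (j : nat) :
  j < size cs -> size cs = size a ->
  perm_eq (spread cs a) (nseq (nth 0 a j) (nth x0 cs j) ++ spread cs (set_nth 0 a j 0)).
Proof.
elim: cs a j => [|c cs IH] [|x a] [|j] //= jc [sc]; rewrite !spread_cons //.
rewrite perm_sym perm_catCA perm_cat2l perm_sym; exact: IH.
Qed.

(** There are [N = 2 ^ m - 1] blocks. The [k <= N] pairs of leaves at the center outside the
    hyperplane go one each into [k] blocks, together with 15 pairs at other centers; the remaining
    [N - k] blocks take 16 pairs at centers in the hyperplane. *)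
Lemma realizable_cross (m j : nat) (z : vect 6) (bs : seq (vect 6)) (b a : seq nat)
    (cs : seq (vect 6)) (F : seq (vect 6 * vect 6)) :
  indep bs -> size bs = 5 -> j < size cs -> nth 0%R cs j = z -> z \notin span bs ->
  (forall i, i < size cs -> i != j -> nth 0%R cs i \in span bs) ->
  labeling b cs F -> size b = size a -> sumn a = (2 ^ m).-1 * 16 ->
  nth 0 a j <= (2 ^ m).-1 ->
  realizable (6 + m) (add_double b a).
Proof.
move=> ib sE jc zj zb csb L sb sa aj; have [sc _ _] := L.
have iE : indep (z :: bs) by rewrite indep_cons zb.
have en := perm_span_enum iE (congr1 S sE).
have /andP[nz _] := labeling_nz L.
pose N := (2 ^ m).-1; pose k := nth 0 a j; pose rest := spread cs (set_nth 0 a j 0).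
have pr : perm_eq (spread cs a) (nseq k z ++ rest).
  by rewrite -zj; apply: spread_extract => //; rewrite sc.
have sr : size rest = k * 15 + (N - k) * 16.
  have := perm_size pr; rewrite size_cat size_nseq (@size_spread _ cs a) ?sc //.
  rewrite sa -/N; move: aj; rewrite -/N -/k; move: (size rest) (k) (N) => *; lia.
have rb : {subset rest <= span bs}.
  move=> u /(mem_spread_nth 0%R)[i [ic ai ->]]; apply: csb => //.
  by apply: contraTneq ai => ->; rewrite nth_set_nth /= eqxx.
have r0 : 0%R \notin rest by apply: contra nz; apply: mem_spread.
have [|ch1 [s1 f1 h1]] := @reshape_chunks _ k 15 (take (k * 15) rest).
  by rewrite size_takel // sr; lia.
have [|ch2 [s2 f2 h2]] := @reshape_chunks _ (N - k) 16 (drop (k * 15) rest).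
  by rewrite size_drop sr; lia.
apply: (@realizable_extend _ _ _ _ _ _ (map (cons z) ch1 ++ ch2) L sb).
- by rewrite size_cat size_map s1 s2 -/N subnKC.
- rewrite perm_sym; apply: perm_trans pr _.
  rewrite flatten_cat f2 -{1}(cat_take_drop (k * 15) rest) -f1 catA perm_cat2r -s1.
  elim: (ch1) => //= c cs' IH; rewrite perm_cons perm_catCA perm_cat2l; exact: IH.
move=> ch; rewrite mem_cat => /orP[/mapP[c /h1[sc' sub] ->]|/h2[sch sub]];
  apply: fills_perm en _ => //.
- apply: fills_two_cosets_cross => // [u /sub /mem_take /rb //|].
  by apply: contra r0 => /sub /mem_take.
- apply: fills_two_cosets => // [u /sub /mem_drop /rb //|].
  by apply: contra r0 => /sub /mem_drop.
Qed.

Lemma lin_head (m : nat) (z : vect m) (bs : seq (vect m)) (c : seq bool) :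
  indep (z :: bs) -> size c = (size bs).+1 -> (lin (z :: bs) c \in span bs) = ~~ head true c.
Proof.
rewrite indep_cons => /andP[zb ib]; case: c => [|a c] //= [sc].
have cb : lin bs c \in span bs by rewrite map_f // mem_masks sc.
case: a; last by rewrite add0r cb.
apply/negbTE; apply: contra zb => h.
by have := span_add h cb; rewrite -addrA addvv addr0.
Qed.

Lemma mem_bits_prepare (r : nat) (b : seq nat) (t : seq nat * seq nat) (cs R : seq (seq bool)) :
  prepare r b t = Some (cs, R) -> forall c, c \in cs -> size c = r.
Proof.
rewrite /prepare; case: (core_rest _ _ _ _) => // R' [<- _] c /mapP[x _ ->].
exact: size_bits.
Qed.

(** The tight base gives [2 * q + 2] vertices, so [2 ^ (r - 2) - q - 1] pairs of leaves are missing
    to reach [2 ^ (r - 1)]. From dimension 6 on, the check keeps only cores whose centers have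
    leading bit 0, which puts them in the hyperplane spanned by [behead E]. *)
Lemma tight_core (r q : nat) (E : seq (vect r)) (a : seq nat) :
  tight_check r q -> indep E -> size E = r -> 0 < q -> size a = q ->
  sumn a = 2 ^ (r - 2) - q - 1 ->
  exists cs F, [/\ labeling (add_double (tight_base q) a) cs F, size cs = q
    & 6 <= r -> {subset cs <= span (behead E)}].
Proof.
move=> chk iE sE q0 sa ua.
have ain : a \in compositions q (2 ^ (r - 2) - q - 1).
  by rewrite -ua -{1}sa; apply: mem_compositions; rewrite -size_eq0 sa; lia.
have stb : size (tight_base q) = q.
  by case: (q) q0 => [|[|k]] //= _; rewrite size_rcons size_nseq.
have /hasP[[cs R]] := allP chk _ ain.
rewrite mem_filter mem_pmap /= => /andP[hd /mapP[t _ tp]] /pfillP.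
have scs : size cs = q.
  move: tp; rewrite /prepare /core_rest; case: ifP => // /andP[/eqP sc _].
  by case: (pull_all _ _) => // R' [-> _]; rewrite sc stb.
rewrite unzip1_zip ?unzip2_zip ?size_map ?scs ?sa // => fR.
have [|sc [F L]] := prepare_labeling iE sE _ (esym tp) fR; first by rewrite stb.
exists (map (lin E) cs), F; split=> //; first by rewrite size_map sc stb.
move=> r6 u /mapP[c cc ->]; have szc := mem_bits_prepare (esym tp) cc.
case: E iE sE {L} => [|z bs] iE /= sE; first by move: r6; rewrite -sE.
rewrite lin_head //; last exact: etrans szc (esym sE).
by move: hd; rewrite ltnNge r6 /= => /allP; apply.
Qed.

(** These parities make every degree odd: an end has one neighbor on the path, an inner vertex two.
    Unlike with [tight_base], an end may carry no leaf. *)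
Definition spine_like (l : seq nat) : Prop :=
  1 < size l /\ forall i, i < size l -> odd (nth 0 l i) = (0 < i < (size l).-1).

Lemma nth_spine_base (q i : nat) : 1 < q -> nth 0 (spine_base q) i = (0 < i < q.-1).
Proof.
case: q => [|[|q]] // _; rewrite /spine_base subn2 /=; case: i => [|i] //=.
rewrite nth_rcons size_nseq nth_nseq ltnS; case: ltngtP => //.
Qed.

Lemma size_spine_base (q : nat) : 1 < q -> size (spine_base q) = q.
Proof. by case: q => [|[|q]] // _; rewrite /= size_rcons size_nseq subn2. Qed.

Lemma sumn_spine_base (q : nat) : 1 < q -> sumn (spine_base q) = q - 2.
Proof. by case: q => [|[|q]] // _; rewrite /= sumn_rcons sumn_nseq; lia. Qed.

Lemma spine_like_double (l : seq nat) : spine_like l ->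
  exists2 a, size a = size l & l = add_double (spine_base (size l)) a.
Proof.
move=> [l1 odd_l]; apply: add_doubleP; first by rewrite size_spine_base.
move=> i il; rewrite nth_spine_base // -(odd_l i il); split; last by rewrite oddb.
by case: (nth 0 l i) => [|x] //; case: (odd _).
Qed.

Lemma spine_like_rev (l : seq nat) : spine_like l -> spine_like (rev l).
Proof.
move=> [l1 odd_l]; split; rewrite ?size_rev // => i il.
rewrite nth_rev // odd_l; last by lia.
by apply/idP/idP; lia.
Qed.

(** A leaf of the end vertex becomes the new end, and the old end becomes an inner vertex with one
    leaf fewer. *)
Lemma spine_like_grow (x : nat) (l : seq nat) : 0 < x -> spine_like (x :: l) ->
  spine_like [:: 0, x.-1 & l].
Proof.
move=> x0 [l1 odd_l]; split=> // -[|[|i]] //= il.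
  by have /= := odd_l 0 isT; move: l1 x0 => /=; lia.
by have := odd_l i.+1 il; rewrite /= => ->; apply/idP/idP; move: il => /=; lia.
Qed.

(** The core leaves no label free in dimension 5, and the vertex count leaves exactly 8 pairs of
    leaves for each of the other [2 ^ m - 1] cosets. *)
Lemma realizable_spine9 (m : nat) (l : seq nat) : spine_like l -> size l = 9 ->
  size l + sumn l = 2 ^ (4 + m) -> realizable (5 + m) l.
Proof.
move=> /spine_like_double[a sa E] sl; rewrite sl in sa E; rewrite {}E.
have sba : size (spine_base 9) = size a by rewrite sa.
rewrite sumn_add_double // sumn_spine_base // size_add_double // size_spine_base // => sum.
have [Eb iE sE] := basis_exists 5; have [cs pc] := spine9_checked.
have pc0 : fills bxor (spread cs (map double (nseq 9 0))) [::].
  suff -> : spread cs (map double (nseq 9 0)) = [::] by exact: fills_nil.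
  by move: (9) => k; elim: k (cs) => [|k IH] [|c cs'] //=; rewrite spread_cons IH.
have [//|_ [F L]] := prepare_labeling iE sE _ pc pc0.
apply: realizable5 L sba _; move: sum; rewrite expnD; have := expn_gt0 2 m; lia.
Qed.

Lemma rev_add_double (b a : seq nat) : size b = size a ->
  rev (add_double b a) = add_double (rev b) (rev a).
Proof. by move=> sb; rewrite /add_double -map_rev rev_zip. Qed.

Lemma rev_spine_base (q : nat) : rev (spine_base q) = spine_base q.
Proof.
by rewrite /spine_base rev_cons rev_rcons rev_nseq.
Qed.

Lemma exists_small_nth (a : seq nat) (N : nat) : sumn a < size a * N.+1 ->
  exists2 j, j < size a & nth 0 a j <= N.
Proof.
elim: a => [|x a IH] //= h; have [le_xN|lt_Nx] := leqP x N; first by exists 0.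
by have [|j ja aj] := IH; [lia|exists j.+1].
Qed.

Lemma realizable_spine17 (m : nat) (l : seq nat) : spine_like l -> size l = 17 ->
  size l + sumn l = 2 ^ (5 + m) -> realizable (6 + m) l.
Proof.
move=> /spine_like_double[a sa E] sl; rewrite sl in sa E; rewrite {}E.
have sba : size (spine_base 17) = size a by rewrite sa.
rewrite sumn_add_double // sumn_spine_base // size_add_double // size_spine_base // => sum.
have {}sum : sumn a = (2 ^ m).-1 * 16.
  by move: sum; rewrite expnD; have := expn_gt0 2 m; lia.
(* Seventeen entries with sum [16 * N], where [N = 2 ^ m - 1], cannot all exceed [N]. *)
have [|j ja aj] := @exists_small_nth a (2 ^ m).-1; first by rewrite sum sa; lia.
rewrite sa in ja.
(* Reversing the path exchanges [j] and [16 - j], so the nine tabulated positions suffice. *)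
wlog j9 : j a sa sba sum ja aj / j < 9.
  move=> W; have [|j9] := ltnP j 9; first exact: W.
  rewrite -[add_double _ _]revK; apply: realizable_rev.
  rewrite rev_add_double // rev_spine_base.
  apply: (W (16 - j)); rewrite ?size_rev ?sumn_rev //; try lia.
  by rewrite nth_rev sa; [have -> : 17 - (16 - j).+1 = j by lia|lia].
have [[//|z bs] iE sE] := basis_exists 6.
have ib : indep bs by move: iE; rewrite indep_cons => /andP[].
have := spine17_checked j9; rewrite /spine17_check.
case pc : (prepare _ _ _) => [[cs [|//]]|//] /allP hd.
have pc0 : fills bxor (spread cs (map double (nseq 17 0))) [::].
  suff -> : spread cs (map double (nseq 17 0)) = [::] by exact: fills_nil.
  by move: (17) => k; elim: k (cs) => [|k IH] [|c cs'] //=; rewrite spread_cons IH.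
have [//|sc [F L]] := prepare_labeling iE sE _ pc pc0.
have memH i : i < 17 -> (nth 0%R (map (lin (z :: bs)) cs) i \in span bs) = (i != j).
  move=> i17; rewrite (nth_map [::]) ?sc // lin_head //; last first.
    by rewrite (mem_bits_prepare pc) ?mem_nth ?sc //; case: sE => ->.
  by rewrite (eqP (hd i _)) // mem_iota.
apply: (@realizable_cross m j _ bs _ _ _ _ ib _ _ erefl _ _ L) => //.
- by case: sE.
- by rewrite size_map sc.
- by rewrite memH // eqxx.
- by move=> i; rewrite size_map sc => i17 ij; rewrite memH.
Qed.

Lemma realizable_grow (n x : nat) (l : seq nat) :
  0 < x -> realizable n [:: 0, x.-1 & l] -> realizable n (x :: l).
Proof. by move=> x0 /realizable_absorb; rewrite prednK. Qed.

(** A path one or two vertices short of [K] is lengthened by a leaf at one end or at both; neither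
    the tree nor its number of vertices changes. *)
Lemma realizable_near_spine (K n : nat) (l : seq nat) :
  (forall l', spine_like l' -> size l' = K -> size l' + sumn l' = 2 ^ n -> realizable n.+1 l') ->
  spine_like l -> 0 < head 0 l -> 0 < last 0 l -> K - 2 <= size l <= K ->
  size l + sumn l = 2 ^ n -> realizable n.+1 l.
Proof.
move=> H sl; have [l1 _] := sl.
case: l l1 sl => [|x l] //= l1 sl x0 lst sK sum.
have [sK0|sK0] := eqVneq (size l).+1 K; first exact: H.
have sl1 := spine_like_grow x0 sl.
apply: realizable_grow => //.
have [sK1|sK1] := eqVneq (size l).+2 K.
  by apply: H => //=; rewrite -sum; lia.
(* The first end is already extended; reversal gives access to the second one, whose leaf count is
   still positive. *)
rewrite -[X in realizable _ X]revK; apply: realizable_rev.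
have sl2 := spine_like_rev sl1.
have hd : head 0 (rev [:: 0, x.-1 & l]) = last x l.
  have -> (s : seq nat) : head 0 (rev s) = last 0 s.
    by case/lastP: s => // s y; rewrite rev_rcons last_rcons.
  by case: l l1 {sK sum sK0 sl sl1 sK1 sl2 lst}.
case R : (rev _) hd sl2 => [|y r] /= hd sl2; first by move: (congr1 size R); rewrite size_rev.
have y0 : 0 < y by rewrite hd.
have sr : size (y :: r) = (size l).+2 by rewrite -R size_rev.
have sm : y + sumn r = x.-1 + sumn l by rewrite -[LHS]/(sumn (y :: r)) -R sumn_rev.
apply: realizable_grow => //; apply: H; rewrite /=; [exact: spine_like_grow|move: sr => /=; lia|].
by rewrite -sum; move: sr => /=; lia.
Qed.

Lemma size_tight_base (q : nat) : 0 < q -> size (tight_base q) = q.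
Proof. by case: q => [|[|k]] //= _; rewrite size_rcons size_nseq. Qed.

Lemma sumn_tight_base (q : nat) : 0 < q -> sumn (tight_base q) = q + 2.
Proof. by case: q => [|[|k]] //= _; rewrite sumn_rcons sumn_nseq; lia. Qed.

Lemma nth_add_double (b a : seq nat) (i : nat) : size b = size a ->
  nth 0 (add_double b a) i = nth 0 b i + (nth 0 a i).*2.
Proof.
elim: b a i => [|x b IH] [|y a] [|i] //= [sb].
by rewrite -/(add_double _ _) IH.
Qed.

Lemma nth_tight_base (q i : nat) : 1 < q -> i < q ->
  nth 0 (tight_base q) i = if 0 < i < q.-1 then 1 else 2.
Proof.
case: q => [|[|q]] // _; case: i => [|i] //= iq.
rewrite nth_rcons size_nseq nth_nseq ltnS; case: ltngtP => //; lia.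
Qed.

(** Trees with 4 or 8 vertices are cores in dimension 3 or 4. For larger ones [q] decides: a tight
    core in dimension 5 up to 6, the path of 9 vertices up to 9, a tight core in dimension 6 up to
    14, the path of 17 vertices beyond. *)
Lemma realizable_tight (q n : nat) (a : seq nat) :
  0 < q <= 17 -> size a = q -> q + sumn (add_double (tight_base q) a) = 2 ^ n ->
  realizable n.+1 (add_double (tight_base q) a).
Proof.
move=> /andP[q0 q17] sa; have sb := size_tight_base q0.
have sba : size (tight_base q) = size a by rewrite sb sa.
rewrite sumn_add_double // sumn_tight_base // => sum.
have spine K : K - 2 <= q <= K -> 1 < q ->
  (forall l', spine_like l' -> size l' = K -> size l' + sumn l' = 2 ^ n -> realizable n.+1 l') ->
  realizable n.+1 (add_double (tight_base q) a).
  move=> qK q1 H; have sl : size (add_double (tight_base q) a) = q by rewrite size_add_double.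
  apply: (realizable_near_spine H); rewrite ?sl //.
  - split; rewrite sl // => i iq; rewrite nth_add_double // nth_tight_base //.
    by rewrite oddD odd_double addbF; case: ifP.
  - by rewrite -nth0 nth_add_double // nth_tight_base //=; lia.
  - by rewrite -nth_last sl nth_add_double // nth_tight_base ?ltn_predL //; case: ifP; lia.
  - by rewrite sumn_add_double // sumn_tight_base.
case: n sum spine => [|[|[|n]]] sum spine; do ?[by move: sum; lia].
- have q1 : q = 1 by move: sum; lia.
  have chk : tight_check 3 q by rewrite q1; exact: tight_check3.
  have [E iE sE] := basis_exists 3.
  have [|cs [F [L _ _]]] := tight_core chk iE sE q0 sa; last by exists cs, F.
  by move: sum; rewrite -[2 ^ 2]/4 -[2 ^ (3 - 2)]/2; lia.
case: n sum spine => [|m] sum spine.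
  have qin : q \in iota 1 3 by rewrite mem_iota; move: sum; lia.
  have [E iE sE] := basis_exists 4.
  have [|cs [F [L _ _]]] := tight_core (allP tight_check4 _ qin) iE sE q0 sa; last by exists cs, F.
  by move: sum; rewrite -[2 ^ 3]/8 -[2 ^ (4 - 2)]/4; lia.
have p0 := expn_gt0 2 m.
have sum8 : q + 1 + sumn a = 2 ^ m * 8 by move: sum; rewrite !expnS; lia.
have [q6|q6] := leqP q 6.
  have [E iE sE] := basis_exists 5.
  have qin : q \in iota 1 6 by rewrite mem_iota; lia.
  (* [7 - q] pairs complete the tight base to 16 vertices; the others come in multiples of 8. *)
  have [|a1 [a2 [s1 s2 u1 u2 H]]] := @split_double a (7 - q); first by lia.
  have [||cs [F [L _ _]]] := tight_core (a := a1) (allP tight_check5 _ qin) iE sE q0.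
  - by rewrite s1.
  - by rewrite u1 -[2 ^ (5 - 2)]/8; lia.
  rewrite H //; apply: (@realizable5 m _ _ _ _ L).
    by rewrite size_add_double ?s2 // s1.
  by rewrite u2; lia.
have [q9|q9] := leqP q 9.
  apply: (spine 9) => [||l' sl' s9 u9]; [lia|lia|exact: realizable_spine9].
(* At least 10 centers force more than 16 vertices, so dimension 6 is available. *)
case: m p0 sum8 spine {sum} => [|m] p0 sum spine; first by move: sum; lia.
have {}p0 := expn_gt0 2 m.
have {}sum : q + 1 + sumn a = 2 ^ m * 16 by move: sum; rewrite !expnS; lia.
have [q14|q14] := leqP q 14; last first.
  apply: (spine 17) => [||l' sl' s17 u17]; [lia|lia|exact: realizable_spine17].
have [[//|z bs] iE sE] := basis_exists 6.
have qin : q \in iota 10 5 by rewrite mem_iota; lia.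
have [|a1 [a2 [s1 s2 u1 u2 H]]] := @split_double a (15 - q); first by lia.
have [||cs [F [L _ csb]]] := tight_core (a := a1) (allP tight_check6 _ qin) iE sE q0.
- by rewrite s1.
- by rewrite u1 -[2 ^ (6 - 2)]/16; lia.
rewrite H //; apply: (@realizable6 m z bs _ _ _ _ iE _ _ L).
- by case: sE.
- exact: csb.
- by rewrite size_add_double ?s2 // s1.
- by rewrite u2; lia.
Qed.

(** This is [K_2]: center, leaf and edge take the three nonzero vectors of the plane. *)
Lemma realizable_single_leaf : realizable 2 [:: 1].
Proof.
have [E iE sE] := basis_exists 2.
eexists; eexists; apply: (labeling_lin iE sE (cs := [:: [:: true; false]])
  (F := [:: ([:: true; false], [:: false; true])])) => //.
Qed.

(** * Spines of caterpillars *)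

Lemma mem_pair_split (T : eqType) (s : seq T) (u w : T) :
  u \in s -> w \in s -> u != w ->
  (exists s1 s2 s3, s = s1 ++ u :: s2 ++ w :: s3) \/
  (exists s1 s2 s3, s = s1 ++ w :: s2 ++ u :: s3).
Proof.
move=> us ws uw; move: ws; case/splitPr: us => s1 s2.
rewrite mem_cat inE eq_sym (negbTE uw) /= => /orP[] /splitPr[p1 p2].
  by right; exists p1, p2, s2; rewrite -catA.
by left; exists s1, p1, p2.
Qed.

Definition dominating (V : finType) (e : rel V) (s : seq V) : Prop :=
  forall v, v \notin s -> exists2 u, u \in s & e v u.

(** On a dominating path of a tree this counts the leaves hanging at [u], because vertices off the
    path have a single neighbor, which is on it. *)
Definition off_degree (V : finType) (e : rel V) (s : seq V) (u : V) : nat :=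
  #|[set v | (v \notin s) && e u v]|.

Section Spine.
Variables (V : finType) (e : rel V).
Hypotheses (e_sym : symmetric e) (e_irr : irreflexive e) (e_acyclic : acyclic e).
Variable s : seq V.
Hypotheses (s_path : sorted e s) (s_uniq : uniq s) (s_dom : dominating e s).

Lemma spine_segment (s1 s2 s3 : seq V) (u w : V) :
  s = s1 ++ u :: s2 ++ w :: s3 ->
  [/\ path e u (rcons s2 w), uniq (u :: rcons s2 w)
    & {subset u :: rcons s2 w <= s}].
Proof.
move=> E; have E' : s = s1 ++ (u :: rcons s2 w) ++ s3 by rewrite E -cats1 /= -catA.
split.
- move: s_path; rewrite E' => /cat_sorted2[_] /=.
  by rewrite cat_path => /andP[].
- by move: s_uniq; rewrite E' cat_uniq => /and3P[_ _]; rewrite cat_uniq => /and3P[].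
by move=> v vs; rewrite E' !mem_cat vs orbT.
Qed.

(** A chord closes the segment between its ends into a cycle, which has size at least 3 as soon as
    the segment has an inner vertex. *)
Lemma spine_chordless (s1 s2 s3 : seq V) (u w : V) :
  s = s1 ++ u :: s2 ++ w :: s3 -> e u w -> s2 = [::].
Proof.
move=> /spine_segment[p un _] euw.
have := e_acyclic (c := u :: rcons s2 w).
rewrite /ucycle /= rcons_path p last_rcons e_sym euw; move: un => /= -> /(_ isT).
by rewrite size_rcons; case: (s2).
Qed.

(** Two neighbors on the path would give a cycle through [v] and the segment between them. *)
Lemma spine_attach_uniq (v u w : V) :
  v \notin s -> u \in s -> w \in s -> e v u -> e v w -> u = w.
Proof.
move=> vs us ws evu evw; apply/eqP/negPn/negP => uw.
wlog [s1 [s2 [s3 E]]] : u w us ws evu evw uw /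
    exists s1 s2 s3, s = s1 ++ u :: s2 ++ w :: s3.
  move=> W; have [|E] := mem_pair_split us ws uw; first exact: W.
  by apply: (W w u) => //; rewrite eq_sym.
have [p un sub] := spine_segment E.
have := e_acyclic (c := v :: u :: rcons s2 w).
have vn : v \notin u :: rcons s2 w by apply: contra vs => /sub.
rewrite /ucycle /= rcons_path p last_rcons evu e_sym evw.
move: un vn => /= -> -> /(_ isT).
by rewrite size_rcons.
Qed.

(** An edge off the path closes a cycle through the attachment points of its ends: a triangle if
    these coincide, and otherwise a cycle along the segment between them. *)
Lemma off_spine_nonadjacent (v v' : V) : v \notin s -> v' \notin s -> ~~ e v v'.
Proof.
move=> vs vs'; apply/negP => evv'.
have [u us evu] := s_dom vs; have [w ws evw] := s_dom vs'.
have vv' : v != v' by apply: contraTneq evv' => ->; rewrite e_irr.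
have [uw|uw] := eqVneq u w.
  subst w; have := e_acyclic (c := [:: v; u; v']).
  rewrite /ucycle /= evu [e u v']e_sym evw [e v' v]e_sym evv' !inE.
  rewrite (negbTE vv') orbF andbT; case: eqVneq => [vu|_] /=; first by rewrite vu us in vs.
  by case: eqVneq => [uv|_] /= => [|/(_ isT)] //; move: vs'; rewrite -uv us.
wlog [s1 [s2 [s3 E]]] : u w v v' us ws vs vs' evu evw evv' vv' uw /
    exists s1 s2 s3, s = s1 ++ u :: s2 ++ w :: s3.
  move=> W; have [|E] := mem_pair_split us ws uw; first exact: (W u w v v').
  by apply: (W w u v' v); rewrite // 1?eq_sym // e_sym.
have [p un sub] := spine_segment E.
have := e_acyclic (c := v' :: v :: u :: rcons s2 w).
have vn : v \notin u :: rcons s2 w by apply: contra vs => /sub.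
have vn' : v' \notin u :: rcons s2 w by apply: contra vs' => /sub.
rewrite /ucycle /= rcons_path p last_rcons evu e_sym evv' [e w v']e_sym evw.
rewrite inE eq_sym (negbTE vv').
by move: un vn vn' => /= -> -> -> /(_ isT).
Qed.

Lemma spine_next (s1 s3 : seq V) (u y : V) : s = s1 ++ u :: y :: s3 -> e u y.
Proof. by move=> E; have [/= /andP[]] := @spine_segment s1 [::] s3 u y E. Qed.

Lemma count_spine_right (s1 s2 : seq V) (u : V) :
  s = s1 ++ u :: s2 -> count (e u) s2 = (s2 != [::]).
Proof.
case: s2 => [|y s2] E //=; rewrite (spine_next E).
suff /hasPn/negbTE h : {in s2, forall w, ~~ e u w}.
  by apply/eqP; rewrite -[X in _ == X]addn0 eqn_add2l -leqn0 leqNgt -has_count h.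
move=> w /splitPr sw; case: sw E => p1 p2 E; apply/negP => /spine_chordless h.
by have := h s1 (y :: p1) p2 E.
Qed.

Lemma count_spine_left (s1 s2 : seq V) (u : V) :
  s = s1 ++ u :: s2 -> count (e u) s1 = (s1 != [::]).
Proof.
case/lastP: s1 => [|s1 y] E //; rewrite -cats1 count_cat /= addn0.
have E' : s = s1 ++ y :: u :: s2 by rewrite E -cats1 -catA.
rewrite e_sym (spine_next E') cats1.
suff /hasPn/negbTE h : {in s1, forall w, ~~ e u w}.
  rewrite -size_eq0 size_rcons /=; apply/eqP.
  by rewrite -[X in _ == X]add0n eqn_add2r -leqn0 leqNgt -has_count h.
move=> w /splitPr sw; case: sw E' => p1 p2 E'; rewrite e_sym; apply/negP => ewu.
have E2 : s = p1 ++ w :: rcons p2 y ++ u :: s2 by rewrite E' -cats1 -!catA /= -?catA.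
by have := spine_chordless E2 ewu; case: (p2).
Qed.

Lemma spine_degree (s1 s2 : seq V) (u : V) : s = s1 ++ u :: s2 ->
  degree e u = off_degree e s u + (s1 != [::]) + (s2 != [::]).
Proof.
move=> E; rewrite /degree -(cardsID [set v in s]) addnC -addnA; congr (_ + _).
  by apply: eq_card => v; rewrite !inE.
rewrite -(count_spine_right E) -(count_spine_left E).
transitivity (count (e u) s); last by rewrite E count_cat /= e_irr.
rewrite -size_filter -(card_uniqP _); last exact: filter_uniq.
by apply: eq_card => v; rewrite !inE mem_filter.
Qed.

End Spine.

Lemma dominating_rev (V : finType) (e : rel V) (s : seq V) :
  dominating e s -> dominating e (rev s).
Proof.
by move=> d v; rewrite mem_rev => /d[u us evu]; exists u; rewrite ?mem_rev.
Qed.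

Lemma off_degree_rev (V : finType) (e : rel V) (s : seq V) (u : V) :
  off_degree e (rev s) u = off_degree e s u.
Proof. by apply: eq_card => v; rewrite !inE mem_rev. Qed.

Lemma sorted_rev_sym (V : finType) (e : rel V) (s : seq V) :
  symmetric e -> sorted e (rev s) = sorted e s.
Proof. by move=> e_sym; rewrite rev_sorted; case: s => //= x s; apply: eq_path. Qed.

Lemma dominating_behead (V : finType) (e : rel V) (x y : V) (s : seq V) :
  symmetric e -> sorted e [:: x, y & s] -> dominating e [:: x, y & s] ->
  off_degree e [:: x, y & s] x = 0 -> dominating e (y :: s).
Proof.
move=> e_sym /= /andP[exy _] d /eqP; rewrite cards_eq0 => /eqP o v vs.
have [->|vx] := eqVneq v x; first by exists y; rewrite ?mem_head.
have vs' : v \notin [:: x, y & s] by rewrite inE negb_or vx.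
have [u + evu] := d v vs'; rewrite inE => /orP[/eqP ux|us]; last by exists u.
have : v \in [set v | (v \notin [:: x, y & s]) && e x v] by rewrite inE vs' -ux e_sym.
by rewrite o inE.
Qed.

Lemma trimmed_spine (V : finType) (e : rel V) (s : seq V) :
  symmetric e -> sorted e s -> uniq s -> dominating e s -> s != [::] ->
  exists x s', [/\ sorted e (x :: s'), uniq (x :: s'), dominating e (x :: s')
    & s' = [::] \/ (0 < off_degree e (x :: s') x) && (0 < off_degree e (x :: s') (last x s'))].
Proof.
move=> e_sym; have [n] := ubnP (size s); elim: n s => // n IH [|x [|y s]] // sz ps us ds _.
  by exists x, [::]; split=> //; left.
have step z r : sorted e (z :: r) -> uniq (z :: r) -> dominating e (z :: r) ->
    size r = (size s).+1 -> off_degree e (z :: r) z = 0 ->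
    exists x s', [/\ sorted e (x :: s'), uniq (x :: s'), dominating e (x :: s')
    & s' = [::] \/ (0 < off_degree e (x :: s') x) && (0 < off_degree e (x :: s') (last x s'))].
  case: r => [|w r] // pz uz dz sr oz; apply: (IH (w :: r)) => //.
  - by rewrite sr; move: sz => /=; lia.
  - by case/andP: pz.
  - by case/andP: uz.
  - exact: dominating_behead oz.
have [hx|] := posnP (off_degree e [:: x, y & s] x); first exact: step hx.
have [hl|hl hx] := posnP (off_degree e [:: x, y & s] (last y s)); last first.
  by exists x, (y :: s); split=> //; right; rewrite hx hl.
move=> _; case R : (rev [:: x, y & s]) => [|z r].
  by move: (congr1 size R); rewrite size_rev.
have Ez : z = last y s.
  by move: (congr1 (last z \o rev) R); rewrite /= revK rev_cons last_rcons /= => <-.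
apply: (step z r); rewrite -?R ?sorted_rev_sym ?rev_uniq //.
- exact: dominating_rev.
- by have := congr1 size R; rewrite size_rev /= => -[].
- by rewrite off_degree_rev Ez.
Qed.

Section SpineLengths.
Variables (V : finType) (e : rel V).
Hypotheses (e_sym : symmetric e) (e_irr : irreflexive e) (e_acyclic : acyclic e).
Variable s : seq V.
Hypotheses (s_path : sorted e s) (s_uniq : uniq s) (s_dom : dominating e s).

Lemma find_attach (v u : V) : v \notin s -> u \in s -> e v u -> find (e v) s = index u s.
Proof.
move=> vs us evu; have hs : has (e v) s by apply/hasP; exists u.
have fs : find (e v) s < size s by rewrite -has_find.
have := spine_attach_uniq e_sym e_acyclic s_path s_uniq vs us (mem_nth v fs) evu (nth_find v hs).
by move->; rewrite index_uniq.
Qed.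

Lemma index_adjacent (u w : V) : u \in s -> w \in s -> e u w -> index w s <= (index u s).+1.
Proof.
move=> us ws euw; have uw : u != w by apply: contraTneq euw => ->; rewrite e_irr.
have idx s1 x s2 : s = s1 ++ x :: s2 -> index x s = size s1.
  move=> E; rewrite E index_cat /= eqxx addn0 ifN //.
  by move: s_uniq; rewrite E cat_uniq /= => /and3P[_ /norP[]].
have [[s1 [s2 [s3 E]]]|[s1 [s2 [s3 E]]]] := mem_pair_split us ws uw.
  have E0 := spine_chordless e_sym e_acyclic s_path s_uniq E euw.
  rewrite E0 /= in E; rewrite (idx _ _ _ E) (idx (rcons s1 u) w s3) ?size_rcons //.
  by rewrite E -cats1 -catA.
rewrite (idx _ _ _ E) (idx (s1 ++ w :: s2) u s3) ?size_cat; last by rewrite E -catA.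
by rewrite leqW // leq_addr.
Qed.

Lemma diameter_spine (a b : V) : s != [::] ->
  a \notin s -> e a (head a s) -> b \notin s -> e b (last b s) -> 1 < size s ->
  size s < diameter e.
Proof.
move=> s0 as' ea bs eb s1.
have hd : head a s \in s by case: (s) s0 => //= x r _; rewrite mem_head.
have lt : last b s \in s by case: (s) s0 => //= x r _; rewrite mem_last.
(* [h] is the intended distance from [a]: it grows by at most one along an edge, from 0 at [a] to
   [(size s).+1] at [b], so every walk from [a] to [b] is at least that long. *)
pose h v := if v == a then 0 else if v \in s then (index v s).+1 else (find (e v) s).+2.
have hstep u v : e u v -> h v <= (h u).+1.
  move=> euv; rewrite /h; have [//|va] := eqVneq v a.
  have [ua|ua] := eqVneq u a.
    rewrite ua in euv; case: ifP => vs; last first.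
      have := off_spine_nonadjacent e_sym e_irr e_acyclic s_path s_uniq s_dom as' (negbT vs).
      by rewrite euv.
    have -> := spine_attach_uniq e_sym e_acyclic s_path s_uniq as' vs hd euv ea.
    by case: (s) s0 => //= x r _; rewrite eqxx.
  case: ifP => vs; case: ifP => us.
  - by rewrite ltnS index_adjacent.
  - by rewrite (find_attach (negbT us) vs euv) ltnS leqW // leqW.
  - by rewrite (find_attach (negbT vs) us) // e_sym.
  - have := off_spine_nonadjacent e_sym e_irr e_acyclic s_path s_uniq s_dom
              (negbT us) (negbT vs).
    by rewrite euv.
have hwalk x p : path e x p -> h (last x p) <= h x + size p.
  elim: p x => [|y p IH] x /=; first by rewrite addn0.
  move=> /andP[/hstep hy /IH]; move: (h _) (h _) (h _) hy => *; lia.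
have ab : b != a.
  apply: contraTneq s1 => ba; have {}eb : e a (last b s) by rewrite -{1}ba.
  have hl := spine_attach_uniq e_sym e_acyclic s_path s_uniq as' hd lt ea eb.
  case: (s) s_uniq hl => //= x [|y r] //= /andP[xr _] E.
  by rewrite E mem_last in xr.
have hb : h b = (size s).+1.
  rewrite /h (negbTE ab) (negbTE bs) (find_attach bs lt eb).
  by case: (s) s0 s_uniq => // x r _ ur; rewrite [last b _]/= index_last.
have ha : h a = 0 by rewrite /h eqxx.
(* The default value of [dist] is [#|V|]. Since [a], [b] and the path are distinct vertices, a
   distance of at most [size s] would be below it and hence realized by a walk. *)
have sV : (size s).+1 < #|V|.
  have /card_uniqP E : uniq [:: a, b & s].
    by rewrite /= inE negb_or eq_sym ab as' bs s_uniq.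
  by rewrite -[(size s).+2]/(size [:: a, b & s]) -E max_card.
have le_d : size s < dist e a b.
  rewrite ltnNge; apply/negP => le_ds.
  have lt_d : dist e a b < size (iota 0 #|V|) by rewrite size_iota; lia.
  have hw : has (has_walk e a b) (iota 0 #|V|) by rewrite has_find.
  have := nth_find 0 hw; rewrite -/(dist e a b) nth_iota; last by rewrite size_iota in lt_d.
  case/existsP => p /andP[/hwalk] + /eqP E.
  by rewrite E hb ha size_tuple; lia.
apply: leq_trans le_d _; rewrite /diameter.
by apply: leq_trans (leq_bigmax a); apply: (leq_bigmax b).
Qed.

(** Double counting: each vertex off the path is adjacent to exactly one vertex on it. *)
Lemma sum_off_degree : size s + sumn [seq off_degree e s u | u <- s] = #|V|.
Proof.
rewrite -(cardC (mem s)) (card_uniqP s_uniq); congr (_ + _).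
rewrite sumnE big_map -sum1_card.
transitivity (\sum_(u <- s) \sum_(v in predC (mem s)) e u v).
  apply: eq_bigr => u _; rewrite /off_degree -sum1dep_card big_mkcondr /=.
  by apply: eq_big => v; rewrite ?inE //; case: (e u v).
rewrite exchange_big /=; apply: eq_bigr => v; rewrite inE => vs.
have [w ws evw] := s_dom vs.
rewrite (bigD1_seq w) //= e_sym evw big_seq_cond big1 // => u /andP[us uw].
apply/eqP; rewrite eqb0 e_sym; apply: contra uw => evu; apply/eqP.
exact: (spine_attach_uniq e_sym e_acyclic s_path s_uniq vs us ws).
Qed.

End SpineLengths.

(** * From leaf counts to set-sequential labelings *)

Lemma perm_realign (T U : eqType) (g : T -> U) (F : seq T) (t : seq U) :
  perm_eq (map g F) t -> exists2 F', perm_eq F' F & map g F' = t.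
Proof.
elim: t F => [|u t IH] F p.
  by exists F => //; apply/nilP; rewrite /nilp (perm_size p).
have /mapP[x xF gx] : u \in map g F by rewrite (perm_mem p) mem_head.
have pF := perm_to_rem xF.
have [|F' pF' gF'] := IH (rem x F).
  by rewrite -(perm_cons u) {1}gx -map_cons; apply: perm_trans p; rewrite perm_map // perm_sym.
exists (x :: F'); last by rewrite /= gF' gx.
by rewrite perm_sym; apply: perm_trans pF _; rewrite perm_cons perm_sym.
Qed.

Lemma count_enum (T : finType) (P : pred T) : count P (enum T) = #|P|.
Proof. by rewrite enumT cardE /enum_mem size_filter; apply: eq_count. Qed.

Lemma map_nth_index (T : eqType) (U : Type) (u0 : U) (s : seq T) (t : seq U) :
  uniq s -> size s = size t -> [seq nth u0 t (index v s) | v <- s] = t.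
Proof.
move=> us st; apply: (@eq_from_nth _ u0); first by rewrite size_map.
move=> i; rewrite size_map => il; case: s us st il => [|x s] // us st il.
by rewrite (nth_map x) // index_uniq.
Qed.

Lemma count_spread (T : eqType) (s : seq T) (g : T -> nat) (w : T) :
  uniq s -> w \in s -> count_mem w (spread s (map g s)) = g w.
Proof.
elim: s => [|x s IH] //= /andP[xs us]; rewrite spread_cons count_cat count_nseq inE /=.
have [->|wx] /= := eqVneq w x.
  rewrite mul1n => _; apply/eqP; rewrite -[X in _ == X]addn0 eqn_add2l.
  by apply/eqP/count_memPn; apply: contra xs; apply: mem_spread.
by move=> ws; rewrite mul0n IH.
Qed.

Lemma mem_path_edges (T : Type) (U : eqType) (op : T -> T -> U) (s1 s2 : seq T) (x y : T) :
  op x y \in path_edges op (s1 ++ x :: y :: s2).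
Proof.
case: s1 => [|c s1] /=; first by rewrite mem_head.
by elim: s1 c => [|d s1 IH] c /=; rewrite !inE ?eqxx ?orbT // IH orbT.
Qed.

Lemma path_edgesP (T : eqType) (U : eqType) (op : T -> T -> U) (e : rel T) (s : seq T) (A : U) :
  sorted e s -> A \in path_edges op s -> exists x y, e x y /\ A = op x y.
Proof.
case: s => [|c s] //=; elim: s c => [|d s IH] c //= /andP[ecd ps].
by rewrite inE => /orP[/eqP ->|/(IH _ ps)//]; exists c, d.
Qed.

Lemma map_path_edges_rel (T : Type) (U W Z : Type) (op : T -> T -> U) (op' : W -> W -> Z)
    (g : U -> Z) (f : T -> W) (e : rel T) (s : seq T) :
  (forall x y, e x y -> g (op x y) = op' (f x) (f y)) -> sorted e s ->
  map g (path_edges op s) = path_edges op' (map f s).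
Proof.
move=> h; case: s => [|c s] //=; elim: s c => [|d s IH] c //= /andP[ecd ps].
by rewrite h // IH.
Qed.

Section Realize.
Variables (V : finType) (e : rel V).
Hypotheses (e_sym : symmetric e) (e_irr : irreflexive e) (e_acyclic : acyclic e).
Variable s : seq V.
Hypotheses (s_path : sorted e s) (s_uniq : uniq s) (s_dom : dominating e s).

Let att (v : V) : V := nth v s (find (e v) s).
Let off : seq V := [seq v <- enum V | v \notin s].

Let attP (v : V) : v \notin s -> att v \in s /\ e v (att v).
Proof.
move=> /s_dom[u us evu]; have h : has (e v) s by apply/hasP; exists u.
by split; [rewrite mem_nth -?has_find|apply: nth_find].
Qed.

Let att_uniq (v u : V) : v \notin s -> u \in s -> e v u -> att v = u.
Proof.
move=> vs us evu; have [avs eva] := attP vs.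
exact: (spine_attach_uniq e_sym e_acyclic s_path s_uniq vs).
Qed.

Lemma perm_attach : perm_eq (map att off) (spread s [seq off_degree e s u | u <- s]).
Proof.
apply/allP => w /=; rewrite mem_cat => h.
have ws : w \in s.
  case/orP: h => [/mapP[v + ->]|/mem_spread //].
  by rewrite mem_filter => /andP[/attP[]].
rewrite count_spread // count_map count_filter count_enum; apply/eqP.
apply: eq_card => v; rewrite !inE /= [LHS]andbC.
case vs : (v \in s) => //=; apply/eqP/idP => [<-|ewv].
  by rewrite e_sym; have [] := attP (negbT vs).
by apply: att_uniq => //; rewrite ?vs // e_sym.
Qed.

(** Path vertices receive the center labels and the other vertices the leaf labels. Path edges and
    attachment edges are all the edges, so zero, the vertex labels and the edge labels together
    enumerate the space without repetition. *)
Lemma realizable_set_sequential (m : nat) : 0 < m ->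
  realizable m [seq off_degree e s u | u <- s] -> set_sequential e.
Proof.
move=> m0 [cs [F [sc pF pL]]]; rewrite size_map in sc.
pose g (w : V) : vect m := nth 0%R cs (index w s).
have gs : map g s = cs by rewrite map_nth_index.
(* The pairs are reordered so that the [i]-th one belongs to the center to which the [i]-th vertex
   off the path is attached. *)
have [F' pF' uF'] : exists2 F', perm_eq F' F & unzip1 F' = map g (map att off).
  apply: perm_realign; apply: perm_trans pF _; rewrite -{1}gs map_spread.
  by apply: perm_map; rewrite perm_sym perm_attach.
have off_uniq : uniq off by rewrite filter_uniq // enum_uniq.
have soff : size off = size F'.
  by have := congr1 size uF'; rewrite !size_map.
pose f (v : V) : vect m :=
  if v \in s then g v else nth 0%R (unzip2 F') (index v off).
have fs : map f s = cs.
  by rewrite -gs; apply/eq_in_map => v vs; rewrite /f vs.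
have fo : map f off = unzip2 F'.
  rewrite -[RHS](@map_nth_index _ _ 0%R off) ?size_map //.
  by apply/eq_in_map => v; rewrite mem_filter /f => /andP[/negbTE ->].
have fatt v : v \notin s -> f (att v) = g (att v).
  by move=> /attP[avs _]; rewrite /f avs.
pose es : seq {set V} :=
  path_edges (fun x y => [set x; y]) s ++ [seq [set v; att v] | v <- off].
have labE x y : e x y -> edge_label f [set x; y] = (f x + f y)%R.
  move=> exy; rewrite /edge_label big_setU1 ?big_set1 //.
  by rewrite inE; apply: contraTneq exy => ->; rewrite e_irr.
have labes : map (edge_label f) es = path_edges (vadd m) cs ++ [seq (p.1 + p.2)%R | p <- F'].
  rewrite map_cat (map_path_edges_rel (op' := vadd m) (f := f) labE s_path) fs; congr (_ ++ _).
  rewrite -map_comp; apply: (@eq_from_nth _ 0%R); first by rewrite !size_map.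
  move=> i; rewrite size_map => il.
  have [v0 _] : exists v0 : V, true by case: (off) il => // v *; exists v.
  have vo : nth v0 off i \in off by rewrite mem_nth.
  have vs : nth v0 off i \notin s by move: vo; rewrite mem_filter => /andP[].
  rewrite (nth_map v0) //= (nth_map (0%R, 0%R)) -?soff // labE; last by have [] := attP vs.
  rewrite fatt // addrC; congr (_ + _)%R.
    transitivity (nth 0%R (map g (map att off)) i).
      by rewrite -map_comp (nth_map v0).
    by rewrite -uF' (nth_map (0%R, 0%R)) // -soff.
  by rewrite -(nth_map v0 0%R f) // fo (nth_map (0%R, 0%R)) // -soff.
have pV : perm_eq (s ++ off) (enum V).
  apply: uniq_perm; rewrite ?enum_uniq //.
    rewrite cat_uniq s_uniq off_uniq andbT /=; apply/hasPn => v.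
    by rewrite mem_filter => /andP[].
  by move=> v; rewrite mem_cat mem_filter mem_enum andbT orbN.
have total : perm_eq (0%R :: map f (enum V) ++ map (edge_label f) es) (enum {: vect m}).
  apply: perm_trans pL; rewrite perm_cons labes.
  apply: (@perm_trans _ (map f (s ++ off) ++ path_edges (vadd m) cs ++
                          [seq (p.1 + p.2)%R | p <- F'])).
    by rewrite perm_cat2r perm_map // perm_sym.
  rewrite map_cat fs fo -catA perm_cat2l perm_catCA perm_cat2l.
  exact: perm_block.
have tu : uniq (0%R :: map f (enum V) ++ map (edge_label f) es).
  by rewrite (perm_uniq total) enum_uniq.
move: (tu); rewrite /= mem_cat cat_uniq => /andP[/norP[n0 _] /and3P[uf _ ue]].
have mem_es A : (A \in edges e) = (A \in es).
  apply/idP/idP; last first.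
    rewrite mem_cat inE => /orP[/(path_edgesP s_path)[x [y [exy ->]]]|/mapP[v]].
      by apply/existsP; exists x; apply/existsP; exists y; rewrite exy eqxx.
    rewrite mem_filter => /andP[/attP[_ eva] _] ->.
    by apply/existsP; exists v; apply/existsP; exists (att v); rewrite eva eqxx.
  rewrite inE => /existsP[x /existsP[y /andP[exy /eqP ->]]]; rewrite mem_cat.
  have offm v u : v \notin s -> u \in s -> e v u -> [set v; u] \in [seq [set v; att v] | v <- off].
    move=> vs us evu; apply/mapP; exists v; first by rewrite mem_filter vs mem_enum.
    by rewrite (att_uniq vs us evu).
  have [xs|xs] := boolP (x \in s); have [ys|ys] := boolP (y \in s).
  - have xy : x != y by apply: contraTneq exy => ->; rewrite e_irr.
    have [[s1 [s2 [s3 E]]]|[s1 [s2 [s3 E]]]] := mem_pair_split xs ys xy.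
      have s20 := spine_chordless e_sym e_acyclic s_path s_uniq E exy; rewrite s20 in E.
      by rewrite E (mem_path_edges (fun x y => [set x; y])).
    rewrite e_sym in exy.
    have s20 := spine_chordless e_sym e_acyclic s_path s_uniq E exy; rewrite s20 in E.
    by rewrite setUC E (mem_path_edges (fun x y => [set x; y])).
  - by rewrite setUC (offm y x) ?orbT // e_sym.
  - by rewrite (offm x y) ?orbT.
  - by move: (off_spine_nonadjacent e_sym e_irr e_acyclic s_path s_uniq s_dom xs ys); rewrite exy.
exists m => //; exists f; split.
- move=> x y fxy; have /injectiveP := uf.
  by apply.
- by move=> x; apply: contra n0 => /eqP <-; rewrite map_f // mem_enum.
move=> v v0.
have := perm_mem total v; rewrite mem_enum inE [RHS]inE (negbTE v0) /= => vin.
have cnt : count_mem v (map f (enum V) ++ map (edge_label f) es) = 1.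
  by rewrite count_uniq_mem ?vin //; case/andP: tu.
rewrite -[RHS]cnt count_cat (count_map f) (count_map (edge_label f)); congr (_ + _).
  by rewrite count_enum; apply: eq_card => x; rewrite !inE.
rewrite -size_filter; have ues : uniq [seq A <- es | (edge_label f A == v)].
  by rewrite filter_uniq // (map_uniq ue).
rewrite -(card_uniqP ues); apply: eq_card => A.
by rewrite !inE mem_filter -mem_es andbC inE.
Qed.

End Realize.

Lemma dist_le1 (V : finType) (e : rel V) (v u : V) :
  dist e v u <= 1 -> v = u \/ e v u.
Proof.
(* With at least two vertices, a value at most 1 is below the default [#|V|] and comes from an
   actual walk. *)
move=> d1; have [V1|V1] := leqP #|V| 1.
  by left; apply: (card_le1_eqP (A := predT)).
have lt_d : dist e v u < size (iota 0 #|V|) by rewrite size_iota; lia.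
have hw : has (has_walk e v u) (iota 0 #|V|) by rewrite has_find.
have := nth_find 0 hw; rewrite -/(dist e v u) nth_iota; last by rewrite size_iota in lt_d.
rewrite add0n; case: (dist e v u) d1 => [|[|]] // _ /existsP[p].
  by rewrite (tuple0 p) /= => /eqP ->; left.
case: p => -[|x []] //= _; rewrite andbT => /andP[evx /eqP <-]; by right.
Qed.

Theorem theorem15 (V : finType) (e : rel V) (n k : nat)
  (hcat : caterpillar e)
  (hodd : forall x : V, odd (degree e x))
  (hdiam : diameter e = k) (hk : k <= 18)
  (hn : 0 < n) (hcard : #|V| = 2 ^ (n - 1)) :
  set_sequential e.
Proof.
have [[[e_sym e_irr] _ e_acyclic] [x0 [p0 [pp up dom0]]]] := hcat.
have d0 : dominating e (x0 :: p0).
  move=> v vs; have [u us /dist_le1[vu|evu]] := dom0 v; last by exists u.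
  by rewrite vu us in vs.
have [x [s [ps us ds trim]]] := trimmed_spine (s := x0 :: p0) e_sym pp up d0 isT.
have sum := sum_off_degree e_sym e_acyclic ps us ds.
pose l := [seq off_degree e (x :: s) u | u <- x :: s].
have sl : size l = (size s).+1 by rewrite size_map.
(* A path of several vertices has a leaf at each end; the distance between these leaves exceeds the
   number of path vertices, which is therefore below 18. *)
have q17 : (size s).+1 <= 17.
  case: trim => [->//|/andP[/card_gt0P[a] + /card_gt0P[b]]].
  rewrite !inE => /andP[as' eax] /andP[bs ebx].
  have [//|s1] := leqP (size s) 0; first by lia.
  have := diameter_spine (a := a) (b := b) e_sym e_irr e_acyclic ps us ds isT as' _ bs.
  by rewrite /= [e a _]e_sym [e b _]e_sym eax ebx hdiam => /(_ isT isT s1); lia.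
case: n hn hcard => // n _; rewrite subn1 /= => hcard.
apply: (realizable_set_sequential e_sym e_irr e_acyclic ps us ds (m := n.+1)) => //.
rewrite -/l; rewrite hcard in sum.
have deg i : i < (size s).+1 -> odd (nth 0 l i + (0 < i) + (i.+1 < (size s).+1)).
  move=> il; have := hodd (nth x (x :: s) i).
  have E : x :: s = take i (x :: s) ++ nth x (x :: s) i :: drop i.+1 (x :: s).
    by rewrite -drop_nth // cat_take_drop.
  rewrite (spine_degree e_sym e_irr e_acyclic ps us E) (nth_map x) //.
  by rewrite -!size_eq0 size_take il size_drop -!lt0n subn_gt0.
have [l1|l1] := eqVneq l [:: 1].
  rewrite l1; suff -> : n = 1 by exact: realizable_single_leaf.
  move: sum; rewrite -/l l1; move: (sl); rewrite l1 /= => -[<-].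
  by case: n {hcard} => [|[|n]] //=; rewrite !expnS; lia.
(* By parity, an end carries a positive even number of leaves, an inner vertex an odd number, and a
   single center an odd number other than 1, as [K_2] is set apart. Hence the counts exceed
   [tight_base] by even amounts. *)
have [||a sa E] := @add_doubleP (tight_base (size l)) l.
- by rewrite size_tight_base // sl.
- rewrite sl => i il; move: (deg i il).
  case: trim => [s0|/andP[hx hl]].
    move: il; rewrite s0; case: i => // _ /=; rewrite !addn0 => ol; split=> //.
    move: l1; rewrite /l s0 /=; move: ol; rewrite /l s0 /=.
    by case: (off_degree _ _ _) => [|[|[|]]].
  have [s0|s0] := posnP (size s).
    move: il hx l1; rewrite s0 /l (size0nil s0); case: i => //= _ hx l1.
    rewrite !addn0 => ol; split=> //; move: l1 ol.
    by case: (off_degree _ _ _) => [|[|[|]]].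
  rewrite nth_tight_base //= ltnS.
  have l0 : i = 0 -> 0 < nth 0 l i by move->.
  have lq : i = size s -> 0 < nth 0 l i by move->; rewrite /l (nth_map x) //= nth_last.
  move: (nth 0 l i) l0 lq => y l0 lq.
  have [i0|i0] := posnP i; first by rewrite i0 s0 /= addn0 addn1; move: (l0 i0); lia.
  move: il; rewrite ltnS leq_eqVlt => /orP[/eqP iq|iq].
    by rewrite iq ltnn /= addn0 addn1; move: (lq iq); lia.
  by rewrite iq /= addn1 addn1; lia.
rewrite E; apply: realizable_tight.
- by rewrite sl q17.
- by [].
by rewrite -E sl.
Qed.
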